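(* For $p,q\in\mathbb{N}$ with $\gcd(p,q)=1$, set $\alpha=2\pi p/q$ and $\lambda=e^{i\alpha}$, and let $\mathcal{U}$ be the regular set of $F_\lambda$. Then: (a) If $V$ is a connected component of $\mathcal{U}$, then $\partial V$ is a convex polygon with at most $q$ sides if $q$ is even and at most $2q$ sides if $q$ is odd. (b) If $V$ is a connected component of $\mathcal{U}$, $\ell$ is the period of $V$ and $\gcd(\ell,q)=1$, then either $\partial V$ has $q$ sides and $\partial V$ is a regular polygon, or $q$ is odd and $\partial V$ has $2q$ sides. (c) For some values of $\alpha$ (of the form $2\pi p/q$ with $p,q\in\mathbb{N}$, $\gcd(p,q)=1$) there are connected components of $\mathcal{U}$ that are not regular polygons (i.e. whose boundary is not a regular polygon).
   Context: For $\lambda\in\mathbb{C}$ with $|\lambda|=1$, the map $F_\lambda:\mathbb{C}\to\mathbb{C}$ is $F_\lambda(z)=\lambda(z-H(z))$, where $H(z)=1$ if $\mathrm{Im}(z)\ge 0$ and $H(z)=-1$ if $\mathrm{Im}(z)<0$. It is a bijection. The critical set is $\mathcal{F}=\{z\in\mathbb{C} : \mathrm{Im}(F_\lambda^i(z))=0 \text{ for some } i\in\mathbb{N}\cup\{0\}\}$, and the regular set is $\mathcal{U}=\mathbb{C}\setminus\overline{\mathcal{F}}$, where $\overline{\mathcal{F}}$ is the closure of $\mathcal{F}$. Here $\mathbb{N}=\{1,2,\dots\}$. The period of a connected component $V$ of $\mathcal{U}$ is the least $\ell\ge1$ with $F_\lambda^\ell(V)=V$. $\partial V$ denotes the boundary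 of $V$.
   Formalization: Assumes q ≥ 3: for q = 1, 2 (λ = ±1) the critical set is the real line, the components of U are the two open half-planes and ∂V is a line, not a polygon, so (a) fails; in (c) the value of α is likewise required to have q ≥ 3. *)

(* Defs.v *)
From HB Require Import structures.
From mathcomp Require Import all_boot all_order all_algebra.
From mathcomp Require Import complex.
From mathcomp Require Import all_classical all_reals all_analysis.

Set Implicit Arguments.
Unset Strict Implicit.
Unset Printing Implicit Defensive.

Import Order.TTheory GRing.Theory Num.Theory.
Import numFieldNormedType.Exports.

Local Open Scope classical_set_scope.
Local Open Scope ring_scope.
Local Open Scope complex_scope.

(* MathComp-Analysis puts the usual topology of the plane on R[i]^o (which is
   convertible to R[i]), not on R[i] itself. *)
Notation plane R := (R[i]^o)%type.

Section Dynamics.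
Variable R : realType.
Implicit Types (lambda z : R[i]) (V : set (plane R)) (l : nat).

Definition expi (alpha : R) : R[i] := cos alpha +i* sin alpha.

Definition H z : R[i] := if 0 <= complex.Im z then 1 else -1.

Definition F lambda z : R[i] := lambda * (z - H z).

Definition critical_set lambda : set (plane R) :=
  [set z | exists i : nat, complex.Im (iter i (F lambda) z) = 0].

Definition regular_set lambda : set (plane R) :=
  ~` closure (critical_set lambda).

Definition is_regular_component lambda V :=
  exists2 z, regular_set lambda z &
    V = connected_component (regular_set lambda) z.

Definition is_period lambda V l :=
  [/\ (0 < l)%N,
      iter l (F lambda) @` V = V &
      forall k, (0 < k < l)%N -> iter k (F lambda) @` V <> V].

End Dynamics.

Definition frontier (T : topologicalType) (A : set T) : set T :=
  closure A `\` A°.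

Section Polygons.
Variable R : realType.
Implicit Types (u w : R[i]) (S : set (plane R)).

Definition dot u w : R :=
  complex.Re u * complex.Re w + complex.Im u * complex.Im w.

Definition cross u w : R :=
  complex.Re u * complex.Im w - complex.Im u * complex.Re w.

Definition angle u w : R := acos (dot u w / (Normc.normc u * Normc.normc w)).

Definition segment u w : set (plane R) :=
  [set line_path u w t%:C | t in `[0, 1]%classic].

(* The sides of a polygon with vertices v_0, ..., v_(n-1) are the segments
   [v_i, v_(i+1)], with indices taken modulo n. *)
Definition perimeter n (v : 'I_n -> R[i]) : set (plane R) :=
  \bigcup_(i in [set: 'I_n]) segment (v i) (v (ordS i)).

(* The vertices are listed counterclockwise, and each one lies strictly to the
   left of every side it does not belong to. In particular the vertices are
   distinct, no angle is flat, and n is the actual number of sides. *)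
Definition convex_vertices n (v : 'I_n -> R[i]) :=
  (2 < n)%N /\
  forall i j : 'I_n, j != i -> j != ordS i ->
    0 < cross (v (ordS i) - v i) (v j - v i).

Definition equilateral n (v : 'I_n -> R[i]) :=
  forall i j : 'I_n,
    Normc.normc (v (ordS i) - v i) = Normc.normc (v (ordS j) - v j).

Definition interior_angle n (v : 'I_n -> R[i]) (i : 'I_n) : R :=
  angle (v (ord_pred i) - v i) (v (ordS i) - v i).

Definition equiangular n (v : 'I_n -> R[i]) :=
  forall i j : 'I_n, interior_angle v i = interior_angle v j.

Definition is_convex_polygon n S :=
  exists2 v : 'I_n -> R[i], convex_vertices v & S = perimeter v.

Definition is_regular_polygon n S :=
  exists v : 'I_n -> R[i],
    [/\ convex_vertices v, S = perimeter v, equilateral v & equiangular v].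

End Polygons.

(* Main.v *)
(* Let e_n be the side of the real line on which the n-th iterate of a regular
   point z lies. As long as the itineraries agree, iterates of F are rotations by
   lambda^n up to translation, so the points with the itinerary of z form an
   intersection of half planes directed by e_n lambda^-n, and the component of z
   is the interior of this set. For a rational angle these directions are Q-th
   roots of unity, with Q = q for even q and Q = 2q for odd q. A drift argument
   shows that the intersection is bounded, so it is cut out by Q support lines
   and is a polygon with at most Q sides. If the period is coprime to q, the
   return map is a rotation of order q that permutes the sides: the side lengths
   are all equal for even q, and depend on the parity of the index for odd q.
   Finally, for q = 12 and p = 7 there is a component with period 36 that is an
   isosceles triangle with angles 30, 30 and 120 degrees. *)
Require Import Defs.
From HB Require Import structures.
From mathcomp Require Import all_boot all_order all_algebra.
From mathcomp Require Import complex.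
From mathcomp Require Import all_classical all_reals all_analysis.
From mathcomp Require Import ring lra zify.
Import Order.TTheory GRing.Theory Num.Theory.
Import numFieldNormedType.Exports.
Local Open Scope classical_set_scope.
Local Open Scope ring_scope.

Set Implicit Arguments.
Unset Strict Implicit.
Unset Printing Implicit Defensive.
Local Open Scope complex_scope.

(** * Plane geometry and the topology of the plane *)

(** An itinerary imposes infinitely many strict half planes, so neither openness nor finitely many
    sides is automatic. Only finitely many directions occur, and for each of them the infimum over
    the component ([support]) replaces all offsets by one. This requires finite infima, while the
    itinerary is not known in advance to be periodic. The way out: the sideways drift
    [cross (d n) d0] off a line directed by an alleged unbounded direction [d0] equals the absolute
    value of the imaginary part of [lam ^+ n * d0], whatever the signs are, and is therefore
    periodic. A support line may meet the closure in one point only. All corners are thus kept,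
    repetitions included, and the true vertices are extracted from the sides of positive length.
    With this uniform indexing the return map acts on side lengths as a shift of indices; when two
    lengths alternate and one is zero, half of the sides disappear and a regular polygon remains.
    For the triangle, all signs along the orbit are signs of numbers m + c sqrt 3 with integers m
    and c, hence decided by computation. *)

Section Plane.
Variable R : realType.
Implicit Types (x y u w z : R[i]) (a b c r s t : R).

Lemma crossC u w : cross u w = - cross w u.
Proof. by rewrite /cross; ring. Qed.

Lemma crossv u : cross u u = 0.
Proof. by rewrite /cross; ring. Qed.

Lemma crossD u x y : cross u (x + y) = cross u x + cross u y.
Proof. by case: u x y => [? ?] [? ?] [? ?]; rewrite /cross /=; ring. Qed.

Lemma crossN u x : cross u (- x) = - cross u x.
Proof. by case: u x => [? ?] [? ?]; rewrite /cross /=; ring. Qed.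

Lemma crossB u x y : cross u (x - y) = cross u x - cross u y.
Proof. by rewrite crossD crossN. Qed.

Lemma crossZ a u x : cross u (a%:C * x) = a * cross u x.
Proof. by case: u x => [? ?] [? ?]; rewrite /cross /=; ring. Qed.

Lemma cross0 u : cross u 0 = 0.
Proof. by rewrite /cross /= !mulr0 subr0. Qed.

Lemma cross_sumr (I : Type) (r : seq I) (P : pred I) (f : I -> R[i]) u :
  cross u (\sum_(i <- r | P i) f i) = \sum_(i <- r | P i) cross u (f i).
Proof. exact: (big_morph _ (crossD u) (cross0 u)). Qed.

Lemma crossNl x u : cross (- x) u = - cross x u.
Proof. by rewrite !(crossC _ u) crossN. Qed.

Lemma crossZl a x u : cross (a%:C * x) u = a * cross x u.
Proof. by rewrite !(crossC _ u) crossZ mulrN. Qed.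

Lemma cross_suml (I : Type) (r : seq I) (P : pred I) (f : I -> R[i]) u :
  cross (\sum_(i <- r | P i) f i) u = \sum_(i <- r | P i) cross (f i) u.
Proof. by rewrite crossC cross_sumr -sumrN; apply: eq_bigr => i _; rewrite -crossC. Qed.

Lemma crossMM u x y : cross (u * x) (u * y) = dot u u * cross x y.
Proof. by case: u x y => [? ?] [? ?] [? ?]; rewrite /cross /dot /=; ring. Qed.

Lemma dotMM u x y : dot (u * x) (u * y) = dot u u * dot x y.
Proof. by case: u x y => [? ?] [? ?] [? ?]; rewrite /dot /=; ring. Qed.

Lemma dotX u n : dot u u = 1 -> dot (u ^+ n) (u ^+ n) = 1.
Proof.
move=> u1; elim: n => [|n IH]; first by rewrite expr0 /dot /=; ring.
by rewrite exprS dotMM u1 mul1r.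
Qed.

Lemma cross_i_self u : cross u ('i * u) = dot u u.
Proof. by case: u => [? ?]; rewrite /dot /cross /=; ring. Qed.

Lemma dotZ a u x : dot u (a%:C * x) = a * dot u x.
Proof. by case: u x => [? ?] [? ?]; rewrite /dot /=; ring. Qed.

Lemma dotZl a u x : dot (a%:C * u) x = a * dot u x.
Proof. by case: u x => [? ?] [? ?]; rewrite /dot /=; ring. Qed.

Lemma dotNl x y : dot (- x) y = - dot x y.
Proof. by case: x y => [? ?] [? ?]; rewrite /dot /=; ring. Qed.

Lemma cross_three x y u w :
  cross x y * cross u w + cross y u * cross x w + cross u x * cross y w = 0.
Proof. by rewrite /cross; ring. Qed.

(** By the three term relation, [cross v y] is determined by [cross u y] and [cross x y] for every
    [v]; taking [v] to be 1 and the imaginary unit reads off both coordinates. *)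
Lemma cross_eq2 u x y w : cross u x != 0 ->
  cross u y = cross u w -> cross x y = cross x w -> y = w.
Proof.
move=> ne0 e1 e2.
have key v : cross u x * cross v y = cross u x * cross v w.
  have := cross_three u x v y; have := cross_three u x v w.
  by rewrite e1 e2 => <- /addIr/addIr ->.
apply/eqP; rewrite eq_complex.
have := mulfI ne0 (key 1); have := mulfI ne0 (key 'i).
by rewrite /cross /= !mul0r !mul1r !sub0r !subr0 => /oppr_inj -> ->; rewrite !eqxx.
Qed.

Lemma cross0_colinear u x : dot u u = 1 -> cross u x = 0 -> x = (dot u x)%:C * u.
Proof.
case: u x => [u1 u2] [x1 x2]; rewrite /dot /cross /= => e c0.
apply/eqP; rewrite eq_complex /= -[X in X == _]mulr1 -[X in _ && (X == _)]mulr1 -e.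
rewrite -subr_eq0 -[X in _ && X]subr_eq0; apply/andP; split; apply/eqP.
  by transitivity (- u2 * (u1 * x2 - u2 * x1)); [ring|rewrite c0 mulr0].
by transitivity (u1 * (u1 * x2 - u2 * x1)); [ring|rewrite c0 mulr0].
Qed.

Lemma line_pathE x y t : line_path x y t%:C = x + t%:C * (y - x).
Proof. by rewrite /line_path; case: x y => [? ?] [? ?]; apply/eqP; rewrite eq_complex /=; apply/andP; split; apply/eqP; ring. Qed.

Lemma cross_line u x y t :
  cross u (line_path x y t%:C) = (1 - t) * cross u x + t * cross u y.
Proof. by rewrite line_pathE crossD crossZ crossB; ring. Qed.

Lemma sqr_normc u : Normc.normc u ^+ 2 = dot u u.
Proof.
case: u => [a b]; rewrite /dot /= sqr_sqrtr ?addr_ge0 ?sqr_ge0 //.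
Qed.

Lemma normc_ge0 u : 0 <= Normc.normc u.
Proof. by case: u => a b; exact: sqrtr_ge0. Qed.

Lemma normcZ a u : Normc.normc (a%:C * u) = `|a| * Normc.normc u.
Proof. by rewrite Normc.normcM /= expr0n addr0 sqrtr_sqr. Qed.

Lemma normc_unimod u : dot u u = 1 -> Normc.normc u = 1.
Proof. by move=> u1; apply/eqP; rewrite -(@eqrXn2 _ 2) ?normc_ge0 // sqr_normc u1 expr1n. Qed.

Lemma ler_cross u w : `|cross u w| <= Normc.normc u * Normc.normc w.
Proof.
have uw0 : 0 <= Normc.normc u * Normc.normc w by rewrite mulr_ge0 ?normc_ge0.
rewrite -ler_sqr ?nnegrE // exprMn !sqr_normc real_normK ?num_real // -subr_ge0.
have -> : dot u u * dot w w - cross u w ^+ 2 = dot u w ^+ 2 by rewrite /dot /cross; ring.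
exact: sqr_ge0.
Qed.

(** On [R[i]^o] both the norm and the radius of a ball are complex numbers; this trades them for the
    real [Normc.normc] and a real radius. *)
Lemma nbhs_planeP (z : plane R) (A : set (plane R)) :
  nbhs z A <-> exists2 e : R, 0 < e & forall w, Normc.normc (w - z) < e -> A w.
Proof.
rewrite -nbhs_ballE; split.
  move=> [e /= e0 eA]; exists (complex.Re e); first by move: e0; rewrite ltcE => /andP[].
  move=> w we; apply: eA; rewrite -ball_normE /= distrC normc_def.
  move: e0; rewrite ltcE => /andP[/eqP e1 _]; rewrite ltcE /= e1 eqxx /=.
  by case: (w - z) we.
move=> [e e0 eA]; exists e%:C; first by rewrite /= ltcR.
move=> w; rewrite -ball_normE /= distrC => h; apply: eA.
by move: h; rewrite normc_def ltcR; case: (w - z).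
Qed.

Lemma open_planeP (A : set (plane R)) :
  (forall z, A z -> exists2 e : R, 0 < e & forall w, Normc.normc (w - z) < e -> A w) -> open A.
Proof. by move=> h; rewrite openE => z /h /nbhs_planeP. Qed.

Lemma open_half_plane u b : open ([set w | b < cross u w] : set (plane R)).
Proof.
(* The [+ 1] keeps the denominator positive when [u] is zero. *)
apply: open_planeP => z /= bz; exists ((cross u z - b) / (Normc.normc u + 1)).
  by rewrite divr_gt0 ?subr_gt0 // ltr_wpDl ?normc_ge0.
move=> w; rewrite ltr_pdivlMr; last by rewrite ltr_wpDl ?normc_ge0.
move=> h.
have := ler_cross u (w - z); rewrite crossB ler_norml => /andP[h1 _].
have := normc_ge0 (w - z); nra.
Qed.

Lemma closed_half_plane u b : closed ([set w | b <= cross u w] : set (plane R)).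
Proof.
rewrite -openC; have -> : ~` [set w | b <= cross u w] = [set w | - b < cross (- u) w].
  by apply/seteqP; split=> w /=; rewrite crossNl ltrN2; [move/negP; rewrite -ltNge|move=> h; apply/negP; rewrite -ltNge].
exact: open_half_plane.
Qed.

Definition convexp (A : set (plane R)) :=
  forall x y t, A x -> A y -> 0 <= t -> t <= 1 -> A (line_path x y t%:C).

Lemma segment_nearby x y t0 e : 0 < e -> exists2 d, 0 < d &
  forall t, `|t0 - t| < d -> Normc.normc (line_path x y t%:C - line_path x y t0%:C) < e.
Proof.
move=> e0; exists (e / (Normc.normc (y - x) + 1)).
  by rewrite divr_gt0 // ltr_wpDl ?normc_ge0.
move=> t; rewrite ltr_pdivlMr; last by rewrite ltr_wpDl ?normc_ge0.
move=> h.
have -> : line_path x y t%:C - line_path x y t0%:C = (t - t0)%:C * (y - x).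
  by rewrite !line_pathE [in RHS]rmorphB /=; ring.
rewrite normcZ distrC.
have := normc_ge0 (y - x); have := normr_ge0 (t0 - t); nra.
Qed.

Lemma convex_connected (A : set (plane R)) : convexp A -> connected A.
Proof.
have [->|] := eqVneq A set0; first by move=> _; exact: connected0.
move=> /set0P[x Ax] cA.
have -> : A = \bigcup_(y in A) segment x y.
  apply/seteqP; split=> [y Ay|w [y Ay] [t /=]].
    exists y => //; exists 1; first by rewrite /= in_itv /= ler01 lexx.
    by rewrite line_pathE; ring.
  by rewrite in_itv /= => /andP[t0 t1] <-; exact: cA.
apply: bigcup_connected.
  exists x => y Ay; exists 0; first by rewrite /= in_itv /= ler01 lexx.
  by rewrite line_pathE; ring.
move=> y Ay; apply: connected_continuous_connected; first exact: segment_connected.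
apply: continuous_subspaceT => t0.
move=> B /nbhs_planeP[e e0 eB].
have [d d0 dB] := @segment_nearby x y t0 e e0.
by exists d => //= t td; apply: eB; apply: dB.
Qed.
End Plane.

(** * Polygons whose sides are directed by roots of unity *)

Lemma modn_shift (N k j : nat) : (0 < N)%N -> exists2 i, (i < N)%N & j = k + i %[mod N].
Proof.
(* Modulo [N], the term [k * N.-1] stands for the opposite of [k]. *)
move=> N0; exists ((j + k * N.-1) %% N)%N; first exact: ltn_pmod.
case: N N0 => // N _ /=; rewrite modnDmr.
have -> : (k + (j + k * N) = k * N.+1 + j)%N by lia.
by rewrite modnMDl.
Qed.

Lemma periodic_mod (T : Type) (f : nat -> T) (N i j : nat) :
  (forall k, f (k + N)%N = f k) -> i = j %[mod N] -> f i = f j.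
Proof.
move=> fN.
have fE k : f k = f (k %% N)%N.
  rewrite {1}(divn_eq k N) addnC; elim: (k %/ N)%N => [|d IH]; first by rewrite addn0.
  by rewrite mulSnr addnA fN.
by move=> ij; rewrite fE ij -fE.
Qed.

(** [f] does not move at the discarded indices, so its value just after a kept index survives until
    the next one. The default [a + l] of [nth] acts as a final index closing the list. *)
Lemma filter_steps (T : Type) (f : nat -> T) (P : pred nat) a l :
  (forall k, ~~ P k -> f k.+1 = f k) ->
  let s := [seq k <- iota a l | P k] in
  f a = f (nth (a + l)%N s 0) /\
  forall i, (i < size s)%N -> f (nth (a + l)%N s i).+1 = f (nth (a + l)%N s i.+1).
Proof.
move=> fP; elim: l a => [|l IH] a /=; first by rewrite addn0.
have := IH a.+1; rewrite addSnnS; case: ifPn => [Pa|nPa] /= [h0 h1]; last by rewrite -fP.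
by split=> // -[_|i /h1//] /=; rewrite h0.
Qed.

Section HalfPlanes.
Variable R : realType.
Implicit Types (x y u w : R[i]).

Lemma open_half_planes (u : nat -> R[i]) (b : nat -> R) (N : nat) :
  open ([set w | forall k, (k < N)%N -> b k < cross (u k) w] : set (plane R)).
Proof.
elim: N => [|N IH].
  by rewrite (_ : [set _ | _] = setT); [exact: openT|apply/seteqP; split].
rewrite (_ : [set w | _] = [set w | forall k, (k < N)%N -> b k < cross (u k) w] `&`
  [set w | b N < cross (u N) w]); first by apply: openI => //; exact: open_half_plane.
apply/seteqP; split=> w /= => [h|[h hN] k]; first by split=> [k kN|]; apply: h => //; exact: ltnW.
by rewrite ltnS leq_eqVlt => /predU1P[->|/h].
Qed.

(** Any positive step from a point of the closed intersection towards [o] makes all inequalities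
    strict at once, so the family may be infinite. *)
Lemma closure_half_planes (I : Type) (u : I -> R[i]) (b : I -> R) (o : R[i]) :
  (forall i, b i < cross (u i) o) ->
  closure ([set w | forall i, b i < cross (u i) w] : set (plane R)) =
  [set w | forall i, b i <= cross (u i) w].
Proof.
move=> ob; apply/seteqP; split=> w /=.
  move=> cw i; have : closure ([set w | b i <= cross (u i) w] : set (plane R)) w.
    by apply: closureS cw => x /= /(_ i)/ltW.
  by rewrite -(closure_id _).1 //; exact: closed_half_plane.
move=> wb B /nbhs_planeP[e e0 eB].
have [d d0 dB] := @segment_nearby R w o 0 e e0.
pose t := Num.min (d / 2) 1.
have t0 : 0 < t by rewrite lt_min ltr01 divr_gt0.
have t1 : t <= 1 by rewrite ge_min lexx orbT.
exists (line_path w o t%:C); split.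
  by move=> i; rewrite cross_line; have := wb i; have := ob i; nra.
have w0 : line_path w o 0%:C = w by rewrite line_pathE mul0r addr0.
rewrite w0 in dB; apply: eB; apply: dB.
by rewrite sub0r normrN gtr0_norm // gt_min; apply/orP; left; lra.
Qed.

Lemma cross_mid p c n w :
  cross p n * cross c w = cross c n * cross p w + cross p c * cross n w :> R.
Proof. by have := cross_three p n c w; rewrite (crossC n c) (crossC c p); lra. Qed.

End HalfPlanes.

(* [h k] is the largest offset of a half plane directed by [om ^+ k] containing
   [V], so every one of the 2m support lines touches the closure of [V], possibly
   in a single point: such a side has length 0. *)
Section RootPolygon.
Context {R : realType} (m : nat) (om : R[i]).
Hypothesis m1 : (1 < m)%N.
Hypothesis om1 : dot om om = 1.
Hypothesis omm : om ^+ m = -1.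
Hypothesis om_pos : forall b, (0 < b < m)%N -> 0 < complex.Im (om ^+ b).

Lemma cross_om i b : cross (om ^+ i) (om ^+ (i + b)) = complex.Im (om ^+ b).
Proof.
rewrite exprD -[X in cross X _]mulr1 crossMM dotX // mul1r.
by rewrite /cross /= mul1r mul0r subr0.
Qed.

Lemma om_opp i : om ^+ (i + m) = - om ^+ i.
Proof. by rewrite exprD omm mulrN1. Qed.

Lemma om_per i : om ^+ (i + 2 * m) = om ^+ i.
Proof. by rewrite mul2n -addnn addnA !om_opp opprK. Qed.

Lemma om_mod i j : i = j %[mod 2 * m] -> om ^+ i = om ^+ j.
Proof. exact: (@periodic_mod _ (GRing.exp om) _ _ _ om_per). Qed.

Lemma Im_om_ge0 b : (b < m)%N -> 0 <= complex.Im (om ^+ b).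
Proof. by case: b => [|b bm]; [rewrite expr0|rewrite ltW ?om_pos]. Qed.

(** For [b < m] the coefficients are nonnegative sines: the middle direction lies in the cone
    spanned by the two outer ones. *)
Lemma om_mid i a b w : (a <= b)%N ->
  complex.Im (om ^+ b) * cross (om ^+ (i + a)) w =
  complex.Im (om ^+ (b - a)) * cross (om ^+ i) w +
  complex.Im (om ^+ a) * cross (om ^+ (i + b)) w.
Proof.
move=> ab; have := cross_mid (om ^+ i) (om ^+ (i + a)) (om ^+ (i + b)) w.
by rewrite !cross_om -{2}(subnKC ab) addnA cross_om.
Qed.

Lemma cross_om_eq0 k l : cross (om ^+ k) (om ^+ l) = 0 ->
  k = l %[mod 2 * m] \/ (k + m)%N = l %[mod 2 * m].
Proof.
have [i i2m li] := @modn_shift (2 * m) k l ltac:(lia).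
rewrite (om_mod li) cross_om => i0.
have [i_m|m_i] := ltnP i m.
  have [ie|ie] := posnP i; first by left; rewrite li ie addn0.
  by have := @om_pos i; rewrite ie i_m i0 ltxx => /(_ isT).
have [ie|ie] := posnP (i - m); first by right; rewrite li; congr (_ %% _)%N; lia.
have im : (0 < i - m < m)%N by lia.
have := om_pos im; move: i0; rewrite -{1}(subnK m_i) om_opp.
by case: (om ^+ _) => a b /= /eqP; rewrite oppr_eq0 => /eqP ->; rewrite ltxx.
Qed.

Variables (h : nat -> R) (o : R[i]).
Let V : set (plane R) := [set w | forall k, h k < cross (om ^+ k) w].
Hypothesis h_per : forall k, h (k + 2 * m)%N = h k.
Hypothesis Vo : V o.
Hypothesis h_tight : forall k x, (forall w, V w -> x <= cross (om ^+ k) w) -> x <= h k.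

Lemma h_mod i j : i = j %[mod 2 * m] -> h i = h j.
Proof. exact: periodic_mod. Qed.

(** The two outer half planes already imply a half plane in the middle direction, and [h_tight] says
    that the offset chosen there is at least as large. *)
Lemma support_mid i a b : (a <= b)%N -> (0 < b < m)%N ->
  complex.Im (om ^+ (b - a)) * h i + complex.Im (om ^+ a) * h (i + b)%N <=
  complex.Im (om ^+ b) * h (i + a)%N.
Proof.
move=> ab bm; have b0 := om_pos bm.
rewrite [leRHS]mulrC -ler_pdivrMr //; apply: h_tight => w Vw.
rewrite ler_pdivrMr // [leRHS]mulrC om_mid //.
have := Vw i; have := Vw (i + b)%N; have := @Im_om_ge0 a; have := @Im_om_ge0 (b - a).
case/andP: bm => _ bm; rewrite !(leq_ltn_trans _ bm) ?leq_subr // => /(_ isT) ? /(_ isT) ? ? ?.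
nra.
Qed.

Lemma support_opp k : h k + h (k + m)%N < 0.
Proof. by have := Vo k; have := Vo (k + m)%N; rewrite om_opp crossNl; lra. Qed.

Lemma Im_om_gt0 : 0 < complex.Im om.
Proof. by have := @om_pos 1; rewrite m1 expr1 => /(_ isT). Qed.

(** Cramer's rule for the meeting point of the support lines [k] and [k.+1]; the determinant is
    [complex.Im om]. *)
Definition corner k : R[i] :=
  locked (((complex.Im om)^-1)%:C * ((h k)%:C * om ^+ k.+1 - (h k.+1)%:C * om ^+ k)).
Local Notation A := corner.

Lemma cross_corner k : cross (om ^+ k) (A k) = h k.
Proof.
have s0 := lt0r_neq0 Im_om_gt0; rewrite /corner -lock crossZ crossB !crossZ crossv -addn1 cross_om expr1.
by field.
Qed.

Lemma cross_cornerS k : cross (om ^+ k.+1) (A k) = h k.+1.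
Proof.
have s0 := lt0r_neq0 Im_om_gt0; rewrite /corner -lock crossZ crossB !crossZ crossv (crossC (om ^+ k.+1)).
by rewrite -addn1 cross_om expr1; field.
Qed.

Lemma corner_per k : A (k + 2 * m) = A k.
Proof. by rewrite /corner -addSn !h_per !om_per. Qed.

Lemma corner_mod i j : i = j %[mod 2 * m] -> A i = A j.
Proof. exact: periodic_mod corner_per. Qed.

(* If the meeting point of two consecutive support lines violated a third
   constraint, the middle one of the three would not be tight. *)
Lemma corner_ge j k : h j <= cross (om ^+ j) (A k).
Proof.
have [i i2m ji] := @modn_shift (2 * m) k j ltac:(lia).
rewrite (om_mod ji) (h_mod ji) {j ji}.
have h0 := cross_corner k; have h1 := cross_cornerS k; have s0 := Im_om_gt0.
have [->|i0] := posnP i; first by rewrite addn0 h0.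
have [->|i1] := eqVneq i 1%N; first by rewrite addn1 h1.
have [im|mi] := ltnP i m.
  have := @support_mid k 1 i ltac:(lia) ltac:(lia).
  have := @om_mid k 1 i (A k) ltac:(lia).
  by rewrite addn1 h0 h1 expr1; nra.
have [->|i2] := eqVneq i m.
  by rewrite om_opp crossNl h0; have := support_opp k; lra.
have [->|i3] := eqVneq i m.+1.
  rewrite addnS -addSn om_opp crossNl h1; have := support_opp k.+1; lra.
(* Past the opposite directions the roles turn: going round from [k + i], the direction [k] comes
   between [k + i] and [k.+1]. *)
have := @support_mid (k + i) (2 * m - i) (2 * m - i).+1 ltac:(lia) ltac:(lia).
have := @om_mid (k + i) (2 * m - i) (2 * m - i).+1 (A k) ltac:(lia).
have -> : (k + i + (2 * m - i) = k + 2 * m)%N by lia.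
have -> : (k + i + (2 * m - i).+1 = k.+1 + 2 * m)%N by lia.
by rewrite !om_per !h_per h0 h1 subSnn expr1; nra.
Qed.

(** The index is shifted: the side lies on the support line [k.+1], which carries the corners [k]
    and [k.+1]. The length is signed until [side_length_ge0]. *)
Definition side_length k : R := dot (om ^+ k.+1) (A k.+1 - A k).
Local Notation t := side_length.

Lemma corner_step k : A k.+1 = A k + (t k)%:C * om ^+ k.+1.
Proof.
rewrite -cross0_colinear ?dotX //; first by rewrite addrC subrK.
by rewrite crossB cross_corner cross_cornerS subrr.
Qed.

Lemma side_length_ge0 k : 0 <= t k.
Proof.
have := corner_ge k k.+1; rewrite corner_step crossD crossZ cross_corner -addn1 cross_om expr1.
by have := Im_om_gt0; nra.
Qed.

Lemma side_length_per k : t (k + 2 * m) = t k.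
Proof. by rewrite /side_length -addSn !corner_per om_per. Qed.

Lemma side_length_mod i j : i = j %[mod 2 * m] -> t i = t j.
Proof. exact: periodic_mod side_length_per. Qed.

(** The constraints of the two neighbouring lines bound the position on the line [k.+1]: line [k]
    from below and line [k.+2] from above. *)
Lemma on_side k w : (forall j, h j <= cross (om ^+ j) w) ->
  cross (om ^+ k.+1) w = h k.+1 ->
  exists s, [/\ 0 <= s, s <= t k & w = A k + s%:C * om ^+ k.+1].
Proof.
move=> wh wk; pose s := dot (om ^+ k.+1) (w - A k); exists s.
have wE : w = A k + s%:C * om ^+ k.+1.
  rewrite -cross0_colinear ?dotX //; first by rewrite addrC subrK.
  by rewrite crossB wk cross_cornerS subrr.
have s0 := Im_om_gt0; split=> //.
  have := wh k; rewrite {1}wE crossD crossZ cross_corner -addn1 cross_om expr1.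
  by nra.
have Sk : cross (om ^+ k.+2) (om ^+ k.+1) = - complex.Im om.
  by rewrite crossC -(addn1 k.+1) cross_om expr1.
have := wh k.+2; have := cross_cornerS k.+1.
by rewrite corner_step {1}wE !crossD !crossZ Sk; nra.
Qed.

Lemma touching_sides k l x : cross (om ^+ k) x = h k -> cross (om ^+ l) x = h l ->
  cross (om ^+ k) (om ^+ l) = 0 -> k = l %[mod 2 * m].
Proof.
move=> xk xl /cross_om_eq0[//|e].
by have := support_opp k; rewrite (h_mod e) -xl -(om_mod e) om_opp crossNl -xk subrr ltxx.
Qed.

Lemma open_V : open V.
Proof.
rewrite (_ : V = [set w | forall k, (k < 2 * m)%N -> h k < cross (om ^+ k) w]).
  exact: open_half_planes.
apply/seteqP; split=> w /= wh k; first by move=> _; exact: wh.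
have k2 : k = (k %% (2 * m))%N %[mod 2 * m] by rewrite modn_mod.
by rewrite (h_mod k2) (om_mod k2); apply: wh; rewrite ltn_pmod //; lia.
Qed.

Lemma frontierV : frontier V =
  [set w | (forall k, h k <= cross (om ^+ k) w) /\ exists k, cross (om ^+ k) w = h k].
Proof.
rewrite /frontier (closure_half_planes Vo) (interior_id _).1; last exact: open_V.
rewrite /V.
apply/seteqP; split=> w /= [wh].
  move=> /existsNP[k /negP]; rewrite -leNgt => wk; split=> //; exists k.
  by apply/le_anti; rewrite wk wh.
by move=> [k wk]; split=> // /(_ k); rewrite wk ltxx.
Qed.

Lemma next_side d k : 0 < t (k + d) -> exists2 j, 0 < t j & A k = A j.
Proof.
elim: d k => [|d IH] k; first by rewrite addn0; exists k.
have [tk|] := ltP 0 (t k); first by exists k.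
move=> tk; rewrite addnS -addSn => /IH[j tj Aj]; exists j => //.
rewrite -Aj corner_step.
by have -> : t k = 0; [apply/le_anti; rewrite tk side_length_ge0|rewrite mul0r addr0].
Qed.

Lemma some_side : exists k, 0 < t k.
Proof.
apply: contrapT => /forallNP t0.
have t00 k : t k = 0 by apply/le_anti; rewrite side_length_ge0 leNgt; have /negP -> := t0 k.
have A0 k : A k = A 0.
  by elim: k => // k IH; rewrite corner_step t00 mul0r addr0.
have := support_opp 0; rewrite add0n -(cross_corner 0) -(cross_corner m) (A0 m).
by rewrite -[m]add0n om_opp crossNl subrr ltxx.
Qed.

(** By tightness from both inclusions, the offset in direction [j + r] is the one in direction [j]
    corrected by the translation. Corners then map to corners, and rotations keep lengths. *)
Lemma side_length_rot r c : (forall w, V w -> V (om ^+ r * w + c)) ->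
  (forall w, V w -> exists2 w', V w' & w = om ^+ r * w' + c) ->
  forall k, t (k + r)%N = t k.
Proof.
move=> Vr Vr' k.
have rot j x y : cross (om ^+ (j + r)) (om ^+ r * x + y) =
    cross (om ^+ j) x + cross (om ^+ (j + r)) y.
  by rewrite crossD exprD mulrC crossMM dotX // mul1r.
have hE j : h (j + r)%N = h j + cross (om ^+ (j + r)) c.
  apply/le_anti/andP; split.
    rewrite -lerBlDr; apply: h_tight => w /Vr/(_ (j + r)%N)/ltW.
    by rewrite rot lerBlDr.
  apply: h_tight => w /Vr'[w' Vw' ->]; rewrite rot lerD2r; exact/ltW/Vw'.
have AE j : A (j + r) = om ^+ r * A j + c.
  apply: (@cross_eq2 _ (om ^+ (j + r)) (om ^+ (j + r).+1)).
  - by rewrite -addn1 cross_om expr1 gt_eqF ?Im_om_gt0.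
  - by rewrite cross_corner rot cross_corner hE.
  - by rewrite cross_cornerS -addSn rot cross_cornerS hE.
rewrite /side_length -!addSn !AE opprD addrACA subrr addr0 -mulrBr addnC exprD.
by rewrite dotMM dotX // mul1r.
Qed.

(** * Polygons from an enumeration [kap] of the sides of positive length, modulo [2 * m] *)

Section Vertices.
Variables (n : nat) (kap : 'I_n -> nat).
Hypothesis n0 : (0 < n)%N.
Hypothesis kap_side : forall i, 0 < t (kap i).
Hypothesis kap_next : forall i, A (kap i).+1 = A (kap (ordS i)).
Hypothesis kap_inj : forall i j, kap i = kap j %[mod 2 * m] -> i = j.
Hypothesis kap_surj : forall k, 0 < t k -> exists i, k = kap i %[mod 2 * m].
Let v i := A (kap i).

Lemma vertex_step i : v (ordS i) = v i + (t (kap i))%:C * om ^+ (kap i).+1.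
Proof. by rewrite /v -kap_next corner_step. Qed.

Lemma parallel_sides i j x : cross (om ^+ (kap i).+1) x = h (kap i).+1 ->
  cross (om ^+ (kap j).+1) x = h (kap j).+1 ->
  cross (om ^+ (kap i).+1) (om ^+ (kap j).+1) = 0 -> i = j.
Proof.
move=> xi xj /(touching_sides xi xj) e; apply: kap_inj.
by apply/eqP; rewrite -(eqn_modDr 1) !addn1; apply/eqP.
Qed.

(** Two sides starting at the same corner end on the allowed side of each other's line. This bounds
    the cross product of their directions from both sides by zero, so they are parallel and
    equal. *)
Lemma vertex_inj : injective v.
Proof.
move=> i j vij; apply: (@parallel_sides _ _ (v i)); rewrite ?cross_cornerS //.
  by rewrite vij cross_cornerS.
have vS k l : h (kap k).+1 <= cross (om ^+ (kap k).+1) (v l) by exact: corner_ge.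
have hi := vS i (ordS j); have hj := vS j (ordS i).
rewrite vertex_step crossD crossZ -vij [cross _ (v i)]cross_cornerS in hi.
rewrite vertex_step crossD crossZ vij [cross _ (v j)]cross_cornerS in hj.
have ti := kap_side i; have tj := kap_side j.
rewrite crossC in hj; apply/le_anti/andP; split; nra.
Qed.

(** With at most two vertices, going forward twice returns to the start, so two positive multiples
    of side directions cancel. These sides share a point and are parallel, hence are one side, whose
    double cannot vanish. *)
Lemma vertices_gt2 : (2 < n)%N.
Proof.
have [//|n2] := ltnP.
have two (i : 'I_n) : ordS (ordS i) = i.
  have two' N k : (0 < N)%N -> (N <= 2)%N -> (k < N)%N -> ((k.+1 %% N).+1 %% N)%N = k.
    by case: N => [|[|[|]]] //; case: k => [|[|]].
  by apply: val_inj; apply: two'.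
pose i := Ordinal n0; have e := vertex_step (ordS i); rewrite two vertex_step in e.
have ti := kap_side i; have tj := kap_side (ordS i).
have e0 : (t (kap i))%:C * om ^+ (kap i).+1 + (t (kap (ordS i)))%:C * om ^+ (kap (ordS i)).+1 = 0.
  by apply: (addrI (v i)); rewrite addrA addr0 -e.
have ij : i = ordS i.
  apply: (@parallel_sides _ _ (v (ordS i))); rewrite ?cross_cornerS //.
    by rewrite /v -kap_next cross_corner.
  apply: (mulfI (lt0r_neq0 tj)); rewrite -crossZ mulr0.
  by have := congr1 (cross (om ^+ (kap i).+1)) e0; rewrite crossD !crossZ crossv mulr0 add0r cross0.
have := congr1 (cross (om ^+ (kap i).+2)) e0; rewrite -ij.
rewrite crossD crossZ (crossC (om ^+ _.+2)) -(addn1 (kap i).+1) cross_om expr1 cross0.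
by have := Im_om_gt0; nra.
Qed.

Lemma vertices_convex : convex_vertices v.
Proof.
split; first exact: vertices_gt2.
move=> i j ji jSi; rewrite vertex_step addrAC subrr add0r crossZl mulr_gt0 ?kap_side //.
rewrite crossB [X in _ - X]cross_cornerS subr_gt0 lt_neqAle corner_ge andbT.
apply/eqP => /esym vj; have [s [s0 st vjE]] := on_side (fun l => corner_ge l _) vj.
move/eqP: ji => ji; move/eqP: jSi => jSi.
have [s00|s_ne0] := eqVneq s 0.
  by apply: ji; apply: vertex_inj; rewrite /v vjE s00 mul0r addr0.
have [s_t|s_net] := eqVneq s (t (kap i)).
  by apply: jSi; apply: vertex_inj; rewrite vertex_step -s_t.
(* Now [v j] is strictly inside side [i]. The support line of side [j] passes through it and has
   both ends of side [i] on the same closed side, so it contains side [i]. *)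
apply: ji; apply/esym; apply: (@parallel_sides _ _ (v j)); rewrite ?cross_cornerS //.
have h1 := corner_ge (kap j).+1 (kap i); have h2 := corner_ge (kap j).+1 (kap (ordS i)).
have := cross_cornerS (kap j); rewrite -/(v _) vertex_step !crossD !crossZ in h2.
rewrite vjE crossD crossZ => h3; rewrite crossC.
have {}s0 : 0 < s by rewrite lt_neqAle eq_sym s_ne0.
have {}st : s < t (kap i) by rewrite lt_neqAle s_net.
rewrite /v in h2; apply/eqP; rewrite oppr_eq0; apply/eqP/le_anti/andP; split.
  rewrite -(pmulr_rle0 _ s0). by lra.
have ts0 : 0 < t (kap i) - s by rewrite subr_gt0.
by rewrite -(pmulr_rge0 _ ts0); lra.
Qed.

Lemma frontier_perimeter : frontier V = perimeter v.
Proof.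
rewrite frontierV; apply/seteqP; split=> w /=.
  (* Predecessor of [k] modulo [2 * m], valid also for [k = 0]: the support line [k] carries the
     side with index [k']. *)
  move=> [wh [k wk]]; pose k' := (k + 2 * m).-1.
  have kk : k'.+1 = (k + 2 * m)%N by rewrite /k' prednK; lia.
  have [|s [s0 st wE]] := @on_side k' w wh; first by rewrite kk h_per om_per.
  have [tk|tk] := ltP 0 (t k').
    have [i ki] := kap_surj tk; exists i => //.
    have ki1 : k'.+1 = (kap i).+1 %[mod 2 * m].
      by apply/eqP; rewrite -(addn1 k') -(addn1 (kap i)) eqn_modDr; apply/eqP.
    exists (s / t k'); last first.
      rewrite line_pathE vertex_step addrAC subrr add0r wE /v -(corner_mod ki).
      rewrite -(om_mod ki1) -(side_length_mod ki) mulrA -rmorphM /= divfK //.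
      by rewrite gt_eqF.
    by rewrite /= in_itv /= divr_ge0 ?(ltW tk) //= ler_pdivrMr // mul1r.
  have s00 : s = 0 by lra.
  have wA : w = A k' by rewrite wE s00 mul0r addr0.
  have [j tj Aj] : exists2 j, 0 < t j & A k' = A j.
    (* A representative, at least [k'], of a side known to have positive length; walking forward to
       it must meet a first such side. *)
    pose i0 := Ordinal n0; pose j := (kap i0 + k' * (2 * m))%N.
    have jk : (k' <= j)%N by rewrite /j; nia.
    apply: (@next_side (j - k')); rewrite subnKC // (@side_length_mod j (kap i0)) //.
    by rewrite /j addnC modnMDl.
  have [i ji] := kap_surj tj; exists i => //; exists 0; first by rewrite /= in_itv /= lexx ler01.
  by rewrite line_pathE mul0r addr0 wA Aj /v; exact: corner_mod.
move=> [i _] [s]; rewrite /= in_itv /= => /andP[s0 s1] <-; split.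
  move=> k; rewrite cross_line.
  have := corner_ge k (kap i); have := corner_ge k (kap (ordS i)); rewrite /v; nra.
exists (kap i).+1; rewrite cross_line /v -kap_next cross_corner cross_cornerS; ring.
Qed.

End Vertices.

Lemma corner_flat k : ~~ (0 < t k) -> A k.+1 = A k.
Proof.
rewrite -leNgt => tk; rewrite corner_step.
by have -> : t k = 0; [apply/le_anti; rewrite tk side_length_ge0|rewrite mul0r addr0].
Qed.

Lemma frontier_convex_polygon :
  exists n, is_convex_polygon n (frontier V) /\ (n <= 2 * m)%N.
Proof.
pose s := [seq k <- iota 0 (2 * m) | 0 < t k].
have [s0 sS] := @filter_steps _ A (fun k => 0 < t k) 0 (2 * m)%N corner_flat.
rewrite -/s add0n in s0 sS.
have modlt k : (k %% (2 * m) < 2 * m)%N by rewrite ltn_pmod //; lia.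
have s_surj k : 0 < t k -> (k %% (2 * m))%N \in s.
  by move=> tk; rewrite mem_filter mem_iota leq0n add0n modlt !andbT (@side_length_mod _ k) ?modn_mod.
have n0 : (0 < size s)%N.
  by rewrite lt0n size_eq0; apply/eqP => e; have [l /s_surj] := some_side; rewrite e.
pose kap (i : 'I_(size s)) := nth (2 * m)%N s i.
have kapP i : (0 < t (kap i)) && (kap i < 2 * m)%N.
  by have := mem_nth (2 * m)%N (ltn_ord i); rewrite mem_filter mem_iota.
have kap_side i : 0 < t (kap i) by case/andP: (kapP i).
have kap_next i : A (kap i).+1 = A (kap (ordS i)).
  rewrite /kap sS //=; have [lt|ge] := ltnP i.+1 (size s); first by rewrite modn_small.
  have -> : i.+1 = size s by apply/eqP; rewrite eqn_leq ltn_ord ge.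
  (* After the last kept index the default [2 * m] is read, and its corner is that of index 0, which
     equals the first listed one. *)
  by rewrite modnn nth_default // -s0 -(@corner_per 0).
have kap_inj i j : kap i = kap j %[mod 2 * m] -> i = j.
  have /andP[_ ?] := kapP i; have /andP[_ ?] := kapP j.
  rewrite !modn_small // => /eqP; rewrite nth_uniq ?filter_uniq ?iota_uniq //.
  by move=> /eqP/val_inj.
have kap_surj k : 0 < t k -> exists i, k = kap i %[mod 2 * m].
  move=> /s_surj ks; have lt := ks; rewrite -index_mem in lt.
  by exists (Ordinal lt); rewrite /kap /= nth_index // modn_mod.
exists (size s); split; last by rewrite size_filter (leq_trans (count_size _ _)) ?size_iota.
exists (fun i => A (kap i)); first exact: vertices_convex.
exact: frontier_perimeter.
Qed.

Lemma frontier_all_sides : (forall k, 0 < t k) -> is_convex_polygon (2 * m) (frontier V).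
Proof.
move=> t0; pose kap (i : 'I_(2 * m)) : nat := i.
have kap_next i : A (kap i).+1 = A (kap (ordS i)).
  by apply: corner_mod; rewrite /kap /= modn_mod.
have kap_inj i j : kap i = kap j %[mod 2 * m] -> i = j.
  by rewrite /kap !modn_small ?ltn_ord // => /val_inj.
have m0 : (0 < 2 * m)%N by lia.
have kap_surj k : 0 < t k -> exists i, k = kap i %[mod 2 * m].
  by move=> _; exists (Ordinal (ltn_pmod k m0)); rewrite /kap /= modn_mod.
exists (fun i => A (kap i)); first exact: (@vertices_convex _ kap).
exact: (@frontier_perimeter _ kap).
Qed.

(** Flat sides are skipped, so consecutive vertices are joined by steps of length [tau] whose
    directions differ by the fixed rotation [om ^+ g]; this fixes the interior angle too. *)
Lemma frontier_regular (g r n : nat) (tau : R) : (g * n = 2 * m)%N -> (r < g)%N ->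
  (forall k, (k %% g)%N <> r -> t k = 0) -> (forall k, (k %% g)%N = r -> t k = tau) ->
  0 < tau -> is_regular_polygon n (frontier V).
Proof.
move=> gn rg t_out t_in tau0; pose kap (i : 'I_n) : nat := (r + i * g)%N.
have g0 : (0 < g)%N by lia.
have n0 : (0 < n)%N by case: (n) gn => //; lia.
have kapE i : (kap i %% g)%N = r by rewrite /kap addnC modnMDl modn_small.
have tkap i : t (kap i) = tau by apply: t_in.
have kap_side i : 0 < t (kap i) by rewrite tkap.
have kapS i : (kap i + g)%N = kap (ordS i) %[mod 2 * m].
  rewrite /kap /= -addnA -mulSnr -gn (mulnC g n).
  by apply/eqP; rewrite eqn_modDl muln_modl modn_mod.
have flat k d : (k %% g)%N = r -> (d < g)%N -> A (k.+1 + d) = A k.+1.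
  move=> kr; elim: d => [|d IH] dg; first by rewrite addn0.
  have out : ((k.+1 + d) %% g)%N <> r.
    rewrite addSnnS -modnDml kr => e.
    have := eqn_modDl r d.+1 0 g; rewrite addn0 (modn_small rg) e eqxx.
    by rewrite mod0n modn_small.
  by rewrite addnS corner_step (t_out _ out) [X in _ + X]mul0r addr0 IH // ltnW.
have kap_next i : A (kap i).+1 = A (kap (ordS i)).
  by rewrite -(corner_mod (kapS i)) -(@flat _ g.-1) ?prednK // addSnnS prednK.
have kap_lt i : (kap i < 2 * m)%N by rewrite /kap -gn; have := ltn_ord i; nia.
have kap_inj i j : kap i = kap j %[mod 2 * m] -> i = j.
  rewrite !modn_small // => /eqP; rewrite eqn_add2l eqn_pmul2r // => /eqP/val_inj //.
have kap_surj k : 0 < t k -> exists i, k = kap i %[mod 2 * m].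
  move=> tk; have kr : (k %% g)%N = r.
    by have [//|/eqP/t_out t0] := eqVneq (k %% g)%N r; rewrite t0 ltxx in tk.
  have lt : ((k %/ g) %% n < n)%N by rewrite ltn_pmod.
  exists (Ordinal lt); rewrite /kap /= {1}(divn_eq k g) kr addnC -gn (mulnC g n).
  by apply/eqP; rewrite eqn_modDl muln_modl modn_mod.
exists (fun i => A (kap i)); split; first exact: vertices_convex.
- exact: frontier_perimeter.
- have len i : Normc.normc (A (kap (ordS i)) - A (kap i)) = tau.
    by rewrite (vertex_step kap_next) addrAC subrr add0r tkap normcZ normc_unimod ?dotX // mulr1 gtr0_norm.
  by move=> i j; rewrite !len.
suff ang i : interior_angle (fun i => A (kap i)) i =
    acos (- tau ^+ 2 * dot 1 (om ^+ g) / (tau * tau)) by move=> i j; rewrite !ang.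
have step j : A (kap (ordS j)) - A (kap j) = tau%:C * om ^+ (kap j).+1.
  by rewrite (vertex_step kap_next) addrAC subrr add0r tkap.
have norm_step k : Normc.normc (tau%:C * om ^+ k) = tau.
  by rewrite normcZ normc_unimod ?dotX // mulr1 gtr0_norm.
pose j := ord_pred i; have ij : i = ordS j by rewrite /j ord_predK.
have e1 : A (kap (ord_pred i)) - A (kap i) = - (tau%:C * om ^+ (kap j).+1).
  by rewrite -step -ij opprB.
rewrite /interior_angle /angle e1 step normcN !norm_step dotNl dotZl dotZ mulrA -expr2 !mulNr.
congr (acos (- (_ * _ / _))).
have -> : om ^+ (kap i).+1 = om ^+ ((kap j).+1 + g).
  apply: om_mod; rewrite ij addSn; apply/eqP.
  by rewrite -(addn1 (kap (ordS j))) -(addn1 (kap j + g)) eqn_modDr (kapS j).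
by rewrite exprD -[X in dot X _]mulr1 dotMM dotX // mul1r.
Qed.

End RootPolygon.

(** * Unbounded directions *)

Section Recession.
Variable R : realType.
Implicit Types (x y u w z : R[i]).

Lemma mul_real_eq0 u w x : dot u u = 1 -> complex.Im w != 0 ->
  complex.Im (u * x) = 0 -> complex.Im (w * (u * x)) = 0 -> x = 0.
Proof.
move=> u1 w0 i1 i2.
have ux0 : u * x = 0.
  move: i1 i2 w0; case: (u * x) w => [a b] [c e] /= ->; rewrite mulr0 add0r => + e0.
  by move/eqP; rewrite mulf_eq0 (negPf e0) /= => /eqP ->.
have : dot (u * x) (u * x) = 0 by rewrite ux0 /dot /= !mulr0 addr0.
rewrite dotMM u1 mul1r -sqr_normc => /eqP; rewrite sqrf_eq0 => /eqP.
exact: Normc.eq0_normc.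
Qed.


Lemma nonneg_sum_eq0 (f : nat -> R) n : (forall j, 0 <= f j) ->
  \sum_(0 <= j < n) f j = 0 -> forall j, (j < n)%N -> f j = 0.
Proof.
move=> f0; elim: n => // n IH; rewrite big_nat_recr //= => /eqP.
rewrite paddr_eq0 ?sumr_ge0 // => /andP[/eqP s0 /eqP fn] j.
by rewrite ltnS leq_eqVlt => /predU1P[->//|]; apply: IH.
Qed.

Lemma pos_sign (e x : R) : e = 1 \/ e = -1 -> x != 0 -> 0 <= e * x -> e = Num.sg x.
Proof.
move=> [->|->] x0; rewrite ?mul1r ?mulN1r ?oppr_ge0 => h.
  by rewrite gtr0_sg // lt_neqAle eq_sym x0.
by rewrite ltr0_sg // lt_neqAle x0.
Qed.

Variables (lam : R[i]) (q : nat) (eps : nat -> R) (z d0 : R[i]).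
Hypothesis q1 : (1 < q)%N.
Hypothesis lamq : lam ^+ q = 1.
Hypothesis lam1 : dot lam lam = 1.
Hypothesis lam_im : complex.Im lam != 0.
Hypothesis eps1 : forall n, eps n = 1 \/ eps n = -1.
Let d n := (eps n)%:C * lam^-1 ^+ n.
(** This is the [n]-th iterate of [z] with the rotation [lam ^+ n] undone, as [orbE] shows later. *)
Let zn n := z - \sum_(0 <= j < n) d j.
Hypothesis zn_ge0 : forall n, 0 <= cross (d n) (zn n).
Hypothesis d0_ge0 : forall n, 0 <= cross (d n) d0.

Lemma unimod_neq0 u : dot u u = 1 -> u != 0.
Proof. by move=> u1; apply/eqP => u0; move: u1; rewrite u0 /dot /= !mulr0 addr0 => /esym/eqP; rewrite oner_eq0. Qed.

Lemma cross_unimod_inv u n x : dot u u = 1 -> cross (u^-1 ^+ n) x = complex.Im (u ^+ n * x).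
Proof.
move=> u1; rewrite -[LHS]mul1r -(dotX n u1) -crossMM -exprMn divff ?unimod_neq0 // expr1n.
by rewrite /cross /= mul1r mul0r subr0.
Qed.

Lemma cross_dir n x : cross (d n) x = eps n * complex.Im (lam ^+ n * x).
Proof. by rewrite crossZl cross_unimod_inv. Qed.

Let a n := complex.Im (lam ^+ n * d0).

Lemma lamD n k : lam ^+ (n + k * q) = lam ^+ n.
Proof. by rewrite exprD mulnC exprM lamq expr1n mulr1. Qed.

Lemma a_per n k : a (n + k * q)%N = a n.
Proof. by rewrite /a lamD. Qed.

Lemma zn_add n r : zn (n + r) = zn n - \sum_(0 <= j < r) d (n + j).
Proof.
elim: r => [|r IH]; first by rewrite addn0 big_geq // subr0.
rewrite addnS /zn big_nat_recr //= opprD addrA -/(zn _) IH [in RHS]big_nat_recr //=.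
by rewrite opprD addrA.
Qed.

Hypothesis d0_neq0 : d0 <> 0.

(** A zero sum of nonnegative terms makes two consecutive terms vanish; as [lam] is not real, [d0]
    would be parallel to two different lines. *)
Lemma drift_gt0 n : 0 < \sum_(0 <= j < q) cross (d (n + j)) d0.
Proof.
rewrite lt_neqAle sumr_ge0 ?andbT //; apply/eqP => /esym s0; apply: d0_neq0.
have [e0 e1] : cross (d n) d0 = 0 /\ cross (d n.+1) d0 = 0.
  have zs := nonneg_sum_eq0 (fun j => d0_ge0 (n + j)) s0.
  by rewrite -[n in d n]addn0 -addn1 !zs // ltnW.
have eps0 k : eps k != 0 by case: (eps1 k) => ->; rewrite ?oppr_eq0 oner_eq0.
apply: (@mul_real_eq0 (lam ^+ n) lam) => //; first exact: dotX.
  by apply: (mulfI (eps0 n)); rewrite mulr0 -cross_dir.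
by apply: (mulfI (eps0 n.+1)); rewrite mulr0 mulrA -exprS -cross_dir.
Qed.

Let y n := cross d0 (zn n).

Lemma y_add n r : y (n + r)%N = y n + \sum_(0 <= j < r) cross (d (n + j)) d0.
Proof.
rewrite /y zn_add crossB cross_sumr -sumrN; congr (_ + _).
by apply: eq_bigr => j _; rewrite -crossC.
Qed.

(** Each increment of [y] is the absolute value of [a n], which is periodic even if the signs [eps]
    are not. So every block of [q] steps adds the same positive amount [M]. *)
Lemma y_eventually_gt0 : exists N, forall n, (N <= n)%N -> 0 < y n.
Proof.
pose M := \sum_(0 <= j < q) cross (d (0 + j)) d0.
have M0 : 0 < M := drift_gt0 0.
have absE n : cross (d n) d0 = `|a n|.
  have := d0_ge0 n; rewrite cross_dir -/(a n); case: (eps1 n) => ->; rewrite ?mul1r ?mulN1r.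
    by move=> ?; rewrite ger0_norm.
  by rewrite oppr_ge0 => ?; rewrite ler0_norm.
have yk k : y (k * q)%N = y 0 + k%:R * M.
  elim: k => [|k IH]; first by rewrite mul0r addr0.
  rewrite mulSnr y_add IH -addrA -natr1 mulrDl mul1r; congr (_ + (_ + _)).
  by apply: eq_bigr => j _; rewrite !absE addnC a_per.
have [k kM] : exists k : nat, - y 0 / M < k%:R.
  by exists (Num.bound `|- y 0 / M|); exact: le_lt_trans (ler_norm _) (archi_boundP (normr_ge0 _)).
exists (k * q)%N => n kn; rewrite -(subnKC kn) y_add yk.
rewrite ltr_wpDr ?sumr_ge0 //.
by rewrite ltr_pdivrMr // in kM; lra.
Qed.

(* If all half planes contained the direction [d0], then [zn] would drift away on
   one side of the line directed by [d0]; this forces the signs [eps] to be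
   [q]-periodic eventually, so [zn] moves by a constant [W] in each period. All
   half planes then contain the direction [- W], while the crosses of their
   directions with [W] add up to [cross W W = 0]. Hence [W = 0]: no drift. *)
Lemma no_recession : False.
Proof.
have [N Ny] := y_eventually_gt0.
(* [kp] is periodic and carries the sign of [eps]. If [a n] is nonzero, [d0_ge0] forces the sign;
   otherwise [d0] is parallel to the [n]-th line, and the positive [y n] decides on which side of it
   [zn n] lies. *)
pose kp n := if a n == 0 then complex.Re (lam ^+ n * d0) else a n.
have kp_per n : kp (n + q)%N = kp n by rewrite -[q]mul1n /kp a_per lamD.
have eps_kp n : (N <= n)%N -> kp n != 0 /\ eps n = Num.sg (kp n).
  move=> /Ny yn; rewrite /kp; case: ifPn => [/eqP an0|an0]; last first.
    by split=> //; apply: pos_sign => //; have := d0_ge0 n; rewrite cross_dir.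
  have e : complex.Re (lam ^+ n * d0) * complex.Im (lam ^+ n * zn n) = y n.
    rewrite /y -[RHS]mul1r -(dotX n lam1) -crossMM /cross.
    by rewrite -/(a n) an0 mul0r subr0.
  have r0 : complex.Re (lam ^+ n * d0) != 0.
    by apply/eqP => r0; move: yn; rewrite -e r0 mul0r ltxx.
  split=> //; apply: pos_sign => //; have := zn_ge0 n; rewrite cross_dir => h.
  have := yn; rewrite -e => h'; case: (eps1 n) h => ->; nra.
have d_per n : (N <= n)%N -> d (n + q) = d n.
  move=> Nn; rewrite /d; have [_ ->] := eps_kp _ (leq_trans Nn (leq_addr q n)).
  have [_ ->] := eps_kp _ Nn; rewrite kp_per exprVn exprD lamq mulr1.
  by rewrite exprVn.
have d_perk n k : (N <= n)%N -> d (n + k * q) = d n.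
  move=> Nn; elim: k => [|k IH]; first by rewrite addn0.
  by rewrite mulSnr addnA d_per ?(leq_trans Nn) ?leq_addr.
pose W := \sum_(0 <= j < q) d (N + j).
have znW r k : zn (N + r + k * q) = zn (N + r) - k%:R%:C * W.
  rewrite addnAC zn_add (zn_add N r).
  have -> : zn (N + k * q) = zn N - k%:R%:C * W.
    elim: k => [|k IH]; first by rewrite mul0r subr0 addn0.
    rewrite mulSnr addnA zn_add IH -addrA -opprD -natr1 rmorphD mulrDl mul1r.
    congr (_ - (_ + _)); apply: eq_bigr => j _.
    by rewrite addnAC d_perk // leq_addr.
  rewrite addrAC; congr (_ - _ - _); apply: eq_bigr => j _.
  by rewrite addnAC d_perk // leq_addr.
(* With a positive value, sufficiently many moves by the opposite of [W] would take [zn] out of a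
   half plane of fixed direction. *)
have dW r : cross (d (N + r)) W <= 0.
  rewrite leNgt; apply/negP => c0.
  have h k : 0 <= cross (d (N + r)) (zn (N + r)) - k%:R * cross (d (N + r)) W.
    by have := zn_ge0 (N + r + k * q); rewrite d_perk ?leq_addr // znW crossB crossZ.
  pose x := cross (d (N + r)) (zn (N + r)) / cross (d (N + r)) W.
  have := archi_boundP (normr_ge0 x); set k := Num.bound _ => xk.
  have := le_lt_trans (ler_norm x) xk; rewrite ltr_pdivrMr //.
  by have := h k; lra.
have W0 : W = 0.
  have s0 : \sum_(0 <= j < q) (- cross (d (N + j)) W) = 0.
    by rewrite sumrN -cross_suml crossv oppr0.
  have p j : 0 <= - cross (d (N + j)) W by rewrite oppr_ge0.
  have [e0 e1] : - cross (d (N + 0)) W = 0 /\ - cross (d (N + 1)) W = 0.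
    by rewrite !(nonneg_sum_eq0 p s0) // ltnW.
  have eps0 k : eps k != 0 by case: (eps1 k) => ->; rewrite ?oppr_eq0 oner_eq0.
  apply: (@mul_real_eq0 (lam ^+ N) lam) => //; first exact: dotX.
    by apply: (mulfI (eps0 N)); rewrite mulr0 -cross_dir -[N]addn0 -[LHS]opprK e0 oppr0.
  by apply: (mulfI (eps0 N.+1)); rewrite mulr0 mulrA -exprS -cross_dir -addn1 -[LHS]opprK e1 oppr0.
by have := drift_gt0 N; rewrite -cross_suml -/W W0 crossC cross0 oppr0 ltxx.
Qed.

End Recession.

(** * Components as cells of the itinerary partition *)

Section Itinerary.
Context {R : realType} (lam : R[i]).
Implicit Types (x y z w : R[i]).
Hypothesis lam1 : dot lam lam = 1.

Definition side z : R := if 0 <= complex.Im z then 1 else -1.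

Lemma HE z : H z = (side z)%:C.
Proof. by rewrite /H /side; case: ifP => // _; rewrite rmorphN. Qed.

Lemma side_pm1 z : side z = 1 \/ side z = -1.
Proof. by rewrite /side; case: ifP; [left|right]. Qed.

Lemma side_Im_ge0 z : 0 <= side z * complex.Im z.
Proof. by rewrite /side; case: ifPn; rewrite -?ltNge => h; lra. Qed.

Lemma side_eq z w : 0 < side z * complex.Im w -> side w = side z.
Proof.
rewrite /side; case: ifPn => _; case: ifPn => //; rewrite -?ltNge => h; lra.
Qed.

Lemma side_Im_gt0 z : complex.Im z <> 0 -> 0 < side z * complex.Im z.
Proof.
move=> /eqP z0; rewrite lt_neqAle side_Im_ge0 andbT eq_sym mulf_neq0 //.
by case: (side_pm1 z) => ->; rewrite ?oppr_eq0 oner_eq0.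
Qed.

Local Notation orb n z := (iter n (F lam) z).

Definition dir z n : R[i] := (side (orb n z))%:C * lam^-1 ^+ n.
Definition shift z n : R[i] := \sum_(0 <= j < n) dir z j.

Lemma orbE z n : orb n z = lam ^+ n * (z - shift z n).
Proof.
have l0 := unimod_neq0 lam1.
elim: n => [|n IH]; first by rewrite mul1r /shift big_geq // subr0.
rewrite iterS /F HE /shift big_nat_recr //= -/(shift z n) opprD addrA mulrBr [in RHS]mulrBr exprS -mulrA -IH.
by congr (_ - _); rewrite /dir exprVn; field; rewrite expf_neq0.
Qed.

Lemma cross_dirE z n x : cross (dir z n) x = side (orb n z) * complex.Im (lam ^+ n * x).
Proof. by rewrite crossZl cross_unimod_inv. Qed.

Lemma orb_same z w n : (forall k, (k < n)%N -> side (orb k w) = side (orb k z)) ->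
  orb n w = lam ^+ n * (w - shift z n).
Proof.
move=> same; rewrite orbE; congr (_ * (_ - _)); apply: eq_big_nat => j /andP[_ jn].
by rewrite /dir same.
Qed.

(** Because of the strict inequality, a point whose orbit meets the real line lies in no cell, not
    even its own. *)
Definition cell z : set (plane R) :=
  [set w | forall n, 0 < side (orb n z) * complex.Im (orb n w)].

Lemma cell_side z w : cell z w -> forall n, side (orb n w) = side (orb n z).
Proof. by move=> zw n; apply: side_eq. Qed.

(** Once the first [n] sides agree, the [n]-th iterate of [w] is the affine expression given by the
    itinerary of [z], and the two [n]-th inequalities are the same. Strong induction supplies the
    agreement. *)
Lemma cellP z w : cell z w <-> forall n, cross (dir z n) (shift z n) < cross (dir z n) w.
Proof.
have E n : (forall k, (k < n)%N -> side (orb k w) = side (orb k z)) ->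
    side (orb n z) * complex.Im (orb n w) = cross (dir z n) w - cross (dir z n) (shift z n).
  by move=> /orb_same ->; rewrite -crossB cross_dirE.
split=> zw n; first by rewrite -subr_gt0 -E // => k _; apply: cell_side.
elim/ltn_ind: n => n IH; rewrite E ?subr_gt0 // => k /IH; exact: side_eq.
Qed.

Lemma cell_convex z : convexp (cell z).
Proof.
move=> x y t /cellP zx /cellP zy t0 t1; apply/cellP => n; rewrite cross_line.
have xn := zx n; have yn := zy n; have [->|tn0] := eqVneq t 0; first by lra.
have : 0 < t * (cross (dir z n) y - cross (dir z n) (shift z n)).
  by rewrite mulr_gt0 ?subr_gt0 // lt_neqAle eq_sym tn0.
have : 0 <= (1 - t) * (cross (dir z n) x - cross (dir z n) (shift z n)).
  by rewrite mulr_ge0 ?subr_ge0 // ltW.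
by lra.
Qed.

Lemma interior_convex (A : set (plane R)) : convexp A -> convexp A°.
Proof.
move=> cA x y t /nbhs_planeP[e1 e10 h1] /nbhs_planeP[e2 e20 h2] t0 t1.
apply/nbhs_planeP; exists (Num.min e1 e2); first by rewrite lt_min e10.
move=> w; rewrite lt_min => /andP[w1 w2]; pose v := w - line_path x y t%:C.
have -> : w = line_path (x + v) (y + v) t%:C by rewrite line_pathE /v line_pathE; ring.
by apply: cA => //; [apply: h1|apply: h2]; rewrite addrAC subrr add0r.
Qed.

Lemma cell_trans z w x : cell z w -> cell w x <-> cell z x.
Proof. by move=> zw; split=> h n; have := h n; rewrite (cell_side zw). Qed.

(* A sign change of the n-th iterate on a ball avoiding the critical set would
   produce a zero on a segment, since the earlier iterates agree there. *)
Lemma regular_ball z : regular_set lam z -> nbhs (z : plane R) (cell z).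
Proof.
move=> zreg.
have /nbhs_planeP[e e0 eU] : nbhs (z : plane R) (regular_set lam).
  by apply: open_nbhs_nbhs; split=> //; apply: closed_openC; exact: closed_closure.
have ncrit w n : Normc.normc (w - z) < e -> complex.Im (orb n w) <> 0.
  move=> /eU wU wn; apply: wU; apply: subset_closure; by exists n.
apply/nbhs_planeP; exists e => // w we n; elim/ltn_ind: n w we => n IH w we.
have zz : Normc.normc (z - z) < e by rewrite subrr Normc.normc0.
have orbL x : Normc.normc (x - z) < e -> orb n x = lam ^+ n * (x - shift z n).
  by move=> xe; apply: orb_same => k kn; apply: side_eq; exact: IH.
have Imz := side_Im_gt0 (ncrit z n zz); rewrite ltNge; apply/negP => le0.
pose a := side (orb n z) * complex.Im (orb n z).
pose b := side (orb n z) * complex.Im (orb n w).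
have ab : 0 < a - b by rewrite /a /b; lra.
pose t := a / (a - b); have t0 : 0 <= t by rewrite divr_ge0 // ltW.
have t1 : t <= 1 by rewrite ler_pdivrMr // mul1r /a /b; lra.
pose x := line_path z w t%:C.
have xe : Normc.normc (x - z) < e.
  rewrite /x line_pathE addrAC subrr add0r normcZ ger0_norm //.
  by have := normc_ge0 (w - z); nra.
apply: (ncrit x n xe); have s0 : side (orb n z) != 0.
  by case: (side_pm1 (orb n z)) => ->; rewrite ?oppr_eq0 oner_eq0.
apply: (mulfI s0); rewrite mulr0 (orbL x) // -cross_dirE crossB cross_line.
have aE : a = cross (dir z n) z - cross (dir z n) (shift z n).
  by rewrite /a [X in complex.Im X]orbL // -cross_dirE crossB.
have bE : b = cross (dir z n) w - cross (dir z n) (shift z n).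
  by rewrite /b (orbL w) // -cross_dirE crossB.
rewrite (_ : _ - _ = (1 - t) * a + t * b); last by rewrite aE bE; ring.
by rewrite /t; field; rewrite gt_eqF.
Qed.

Lemma regular_cell z : regular_set lam z -> cell z z.
Proof. by move/regular_ball/nbhs_singleton. Qed.

Lemma interior_cell_regular z : (cell z)° `<=` regular_set lam.
Proof.
move=> w wz /(_ _ wz)[x [[n xn] /(_ n)]].
by rewrite xn mulr0 ltxx.
Qed.

Lemma regular_interior z w : regular_set lam w -> cell z w -> (cell z)° w.
Proof. by move=> /regular_ball wb zw; apply: filterS wb => x; exact: (cell_trans _ zw).1. Qed.

(* Inside the component, the cell is relatively open and relatively closed. *)
Lemma component_cell z : regular_set lam z ->
  connected_component (regular_set lam) z = (cell z)°.
Proof.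
move=> zreg; apply/seteqP; split; last first.
  apply: connected_component_max; first exact: regular_ball.
    exact: interior_cell_regular.
  exact/convex_connected/interior_convex/cell_convex.
set U := regular_set lam; set V := connected_component U z.
have VU : V `<=` U by exact: connected_component_sub.
have Vz : V z by exact: connected_component_refl.
suff e : V `&` cell z = V.
  by move=> w Vw; have : (V `&` cell z) w; [rewrite e|case=> _; apply: regular_interior; exact: VU].
have cV : connected V by exact: component_connected.
apply: (cV (V `&` cell z)).
- by exists z; split=> //; exact: regular_cell.
- exists (cell z)°; first exact: open_interior.
  apply/seteqP; split=> w [Vw zw]; (split; first exact: Vw).
    exact: regular_interior (VU _ Vw) zw.
  exact: interior_subset zw.
(* If [w] is outside [cell z], its own cell is a neighbourhood of [w] disjoint from [cell z]: a
   common point would make the two itineraries agree. *)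
- exists (~` (~` cell z)°); first by apply: open_closedC; exact: open_interior.
  apply/seteqP; split=> w [Vw zw]; (split; first exact: Vw).
    by move=> /interior_subset nzw; exact: nzw zw.
  apply: contrapT => nzw; apply: zw.
  apply: filterS (regular_ball (VU _ Vw)) => x wx zx; apply: nzw => n.
  by rewrite -(cell_side zx n) (cell_side wx n); exact: (regular_cell (VU _ Vw)).
Qed.

End Itinerary.

(** * Components for rational angles *)

Lemma periodic_gcd (T : Type) (f : nat -> T) (r N : nat) :
  (forall k, f (k + r)%N = f k) -> (forall k, f (k + N)%N = f k) ->
  forall k, f (k + gcdn r N)%N = f k.
Proof.
move=> fr fN k; have [->|r0] := posnP r; first by rewrite gcd0n.
have fm n d i : (forall k, f (k + n)%N = f k) -> f (i + d * n)%N = f i.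
  by move=> fn; elim: d => [|d IH]; rewrite ?addn0 // mulSnr addnA fn.
have [a b ab _] := egcdnP N r0.
by rewrite -(fm N b _ fN) -addnA [(gcdn _ _ + _)%N]addnC -ab (fm _ _ _ fr).
Qed.

Section RootComponent.
Context {R : realType} (m : nat) (om : R[i]) (e : nat).
Hypothesis m1 : (1 < m)%N.
Hypothesis om1 : dot om om = 1.
Hypothesis omm : om ^+ m = -1.
Hypothesis om_pos : forall b, (0 < b < m)%N -> 0 < complex.Im (om ^+ b).
Let lam := om ^+ e.
Hypothesis lam_im : complex.Im lam != 0.

Let lam1 : dot lam lam = 1. Proof. exact: dotX. Qed.

Lemma om_2m : om ^+ (2 * m) = 1.
Proof. by rewrite mulnC exprM omm sqrrN expr1n. Qed.

Lemma dir_root z n : exists j, dir lam z n = om ^+ j.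
Proof.
have om0 := unimod_neq0 om1.
(* The factor [(2 * m).-1] is -1 modulo [2 * m]; a negative side then adds [m] to the exponent. *)
have lamV : lam^-1 = om ^+ (e * (2 * m).-1).
  apply: (mulfI (expf_neq0 e om0)); rewrite divff ?expf_neq0 // -exprD -mulnS prednK; last by lia.
  by rewrite mulnC exprM om_2m expr1n.
rewrite /dir lamV -exprM; case: (side_pm1 (iter n (F lam) z)) => ->.
  by rewrite mul1r; eexists.
by rewrite rmorphN mulN1r -(om_opp omm); eexists.
Qed.

(** Otherwise [om ^+ k] would be an unbounded direction of all half planes, which [no_recession]
    excludes, with [2 * m] as period of the powers of [lam]. *)
Lemma dir_neg z k : exists n, cross (dir lam z n) (om ^+ k) < 0.
Proof.
apply: contrapT => /forallNP no_neg.
have ge0 n : 0 <= cross (dir lam z n) (om ^+ k) by rewrite leNgt; apply/negP; exact: no_neg.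
apply: (@no_recession _ lam (2 * m) (fun n => side (iter n (F lam) z)) z (om ^+ k)) => //.
- by lia.
- by rewrite /lam -exprM mulnC exprM om_2m expr1n.
- by move=> n; exact: side_pm1.
- by move=> n; rewrite -/(dir lam z n) -/(shift lam z n) cross_dirE // -orbE // side_Im_ge0.
- by apply/eqP; rewrite expf_neq0 // unimod_neq0.
Qed.

Lemma dir_before z k : exists2 i, (0 < i < m)%N & exists n, dir lam z n = om ^+ (k + i).
Proof.
have [n] := dir_neg z k; have [j nj] := dir_root z n.
have [i i2m ji] := @modn_shift (2 * m) k j ltac:(lia).
rewrite nj (om_mod omm ji) crossC cross_om // oppr_lt0 => i0; exists i; last first.
  by exists n; rewrite nj (om_mod omm ji).
have [i00|i00] := posnP i; first by rewrite i00 expr0 ltxx in i0.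
rewrite ltnNge; apply/negP => mi; move: i0; rewrite -(subnK mi) (om_opp omm).
have := @Im_om_ge0 _ _ _ om_pos (i - m) ltac:(lia).
by case: (om ^+ _) => a b /=; lra.
Qed.

(* Every open half circle of directions contains some [dir z n]; the two such
   directions closest to [om ^+ k] from both sides span it positively. *)
Lemma cell_bounded_below z k : exists b, forall w, cell lam z w -> b <= cross (om ^+ k) w.
Proof.
pose P a := `[< exists n, dir lam z n = om ^+ (k + a) >].
have exP : exists a, P a.
  (* Searching from the direction preceding [k] allows the offset 0, that is, [om ^+ k] itself. *)
  have [i i0m [n ni]] := dir_before z (k + (2 * m).-1).
  exists i.-1; apply/asboolP; exists n; rewrite ni; apply: (om_mod omm).
  have -> : (k + (2 * m).-1 + i = k + i.-1 + 2 * m)%N by lia.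
  by rewrite modnDr.
have am : (ex_minn exP < m)%N.
  case: ex_minnP => a _ amin.
  have [i i0m [n ni]] := dir_before z (k + (2 * m).-1).
  apply: (@leq_ltn_trans i.-1); last by lia.
  apply: amin; apply/asboolP; exists n; rewrite ni; apply: (om_mod omm).
  have -> : (k + (2 * m).-1 + i = k + i.-1 + 2 * m)%N by lia.
  by rewrite modnDr.
case: ex_minnP am => a /asboolP[n2 e2] amin am.
(* Searching from the opposite of [k + a] gives the direction [b] steps behind [k + a]. The
   minimality of [a] puts it strictly behind [k], so [om ^+ k] is in the cone of the two
   directions. *)
have [i i0m [n1 e1]] := dir_before z (k + a + m).
pose b := (m - i)%N.
have ab : (a < b)%N.
  rewrite ltnNge; apply/negP => ba; suff : P (a - b)%N by move=> /amin; rewrite /b; lia.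
  apply/asboolP; exists n1; rewrite e1; apply: (om_mod omm).
  have -> : (k + a + m + i = k + (a - b) + 2 * m)%N by rewrite /b; rewrite /b in ba; lia.
  by rewrite modnDr.
have bm : (0 < b < m)%N by rewrite /b; lia.
have Ib := om_pos bm.
pose s n := cross (dir lam z n) (shift lam z n).
exists ((complex.Im (om ^+ a) * s n1 + complex.Im (om ^+ (b - a)) * s n2) / complex.Im (om ^+ b)).
move=> w /(cellP lam1) zw; rewrite ler_pdivrMr //.
have := @om_mid _ _ om1 (k + a + m + i) (b - a) b w (leq_subr _ _).
rewrite subKn 1?ltnW // -e1.
have -> : (k + a + m + i + (b - a) = k + 2 * m)%N by rewrite /b; rewrite /b in ab; lia.
have -> : (k + a + m + i + b = k + a + 2 * m)%N by rewrite /b; lia.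
rewrite !(om_per omm) -e2 [leRHS]mulrC => ->.
have := zw n1; have := zw n2; rewrite -/(s n1) -/(s n2).
have := @Im_om_ge0 _ _ _ om_pos a am; have := om_pos (b := (b - a)%N) ltac:(lia).
by nra.
Qed.

Definition support (V : set (plane R)) k : R := inf [set cross (om ^+ k) w | w in V].

Lemma support_per V k : support V (k + 2 * m) = support V k.
Proof. by rewrite /support (om_per omm). Qed.

Section Cell.
Variable z : R[i].
Hypothesis zreg : regular_set lam z.
Let V : set (plane R) := (cell lam z)°.

Let Vz : V z. Proof. exact: regular_ball. Qed.

Let V_cell w : V w -> cell lam z w. Proof. exact: interior_subset. Qed.

Let has_inf_V k : has_inf [set cross (om ^+ k) w | w in V].
Proof.
split; first by exists (cross (om ^+ k) z), z.
have [b bV] := cell_bounded_below z k; exists b => _ [w /V_cell/bV bw <-]; exact: bw.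
Qed.

Lemma support_le k w : V w -> support V k <= cross (om ^+ k) w.
Proof. by move=> Vw; apply: ge_inf; [exact: (has_inf_V k).2|exists w]. Qed.

Lemma support_tight k x : (forall w, V w -> x <= cross (om ^+ k) w) -> x <= support V k.
Proof. by move=> xV; apply: lb_le_inf; [exact: (has_inf_V k).1|move=> _ [w /xV xw <-]]. Qed.

(** Every constraint of the cell has one of the [2 * m] root directions and is implied by the
    support constraint in that direction. *)
Lemma cell_support : V = [set w | forall k, support V k < cross (om ^+ k) w].
Proof.
apply/seteqP; split=> [w Vw k|w wV] /=.
  have /nbhs_planeP[r r0 rV] : nbhs (w : plane R) V.
    by apply: open_nbhs_nbhs; split=> //; exact: open_interior.
  have u1 := dotX k om1.
  (* Moving by [r / 2] straight towards the support line stays in [V] and lowers the cross product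
     by [r / 2], so the infimum is not attained. *)
  have : V (w - (r / 2)%:C * ('i * om ^+ k)).
    apply: rV; rewrite addrAC subrr add0r normcN normcZ normc_unimod.
      by rewrite mulr1 gtr0_norm; lra.
    by rewrite dotMM u1 /dot /=; ring.
  by move=> /(support_le k); rewrite crossB crossZ cross_i_self u1; lra.
(* Finitely many strict inequalities, hence an open set: once contained in the cell, it is contained
   in the interior. *)
pose B : set (plane R) :=
  [set w | forall k, (k < 2 * m)%N -> support V k < cross (om ^+ k) w].
suff BV : B `<=` cell lam z.
  have Bo : open B by exact: open_half_planes.
  by rewrite /V; apply: (interiorS BV); rewrite (interior_id _).1 // => k _; exact: wV.
move=> x Bx; apply/(cellP lam1) => n; have [j nj] := dir_root z n.
have jm : j = (j %% (2 * m))%N %[mod 2 * m] by rewrite modn_mod.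
apply: (@le_lt_trans _ _ (support V (j %% (2 * m)))).
  by apply: support_tight => y /V_cell/(cellP lam1)/(_ n)/ltW; rewrite {2}nj (om_mod omm jm).
by rewrite nj (om_mod omm jm); apply: Bx; rewrite ltn_pmod //; lia.
Qed.

Lemma component_polygon :
  exists n, is_convex_polygon n (frontier V) /\ (n <= 2 * m)%N.
Proof.
have Vz' : [set w | forall k, support V k < cross (om ^+ k) w] z by rewrite -cell_support.
have tight' : forall k x, (forall w, [set w | forall k, support V k < cross (om ^+ k) w] w ->
  x <= cross (om ^+ k) w) -> x <= support V k.
  by rewrite -cell_support; exact: support_tight.
have := frontier_convex_polygon m1 om1 omm om_pos (support_per V) Vz' tight'.
by rewrite -cell_support.
Qed.

(** All points of [V] share the itinerary of [z], so the [l]-th iterate is one and the same affine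
    map on [V]. *)
Lemma component_rotation l : iter l (F lam) @` V = V ->
  exists c, (forall w, V w -> V (om ^+ (e * l) * w + c)) /\
   forall w, V w -> exists2 w', V w' & w = om ^+ (e * l) * w' + c.
Proof.
move=> lV; have E w : V w -> iter l (F lam) w = om ^+ (e * l) * w + (- lam ^+ l * shift lam z l).
  move=> /V_cell zw; rewrite (@orb_same _ _ lam1 z) ?exprM ?mulrBr ?mulNr // => k _.
  exact: cell_side.
exists (- lam ^+ l * shift lam z l); split=> w Vw.
  have : (iter l (F lam) @` V) (iter l (F lam) w) by exists w.
  by rewrite lV (E w Vw).
have [w' Vw' <-] : (iter l (F lam) @` V) w by rewrite lV.
by exists w'; [exact: Vw'|exact: E].
Qed.

(** The side lengths are periodic with periods [e * l] and [2 * m], hence with their gcd [g]. For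
    [g = 2] the even and the odd sides each have one length: if one of these is zero, a regular
    polygon with [q] sides is left, otherwise all [2 * q] sides are present. *)
Lemma component_periodic l q g : iter l (F lam) @` V = V ->
  (2 * m = g * q)%N -> gcdn (e * l) (2 * m) = g -> (g = 1%N) \/ (g = 2%N) ->
  is_regular_polygon q (frontier V) \/ g = 2%N /\ is_convex_polygon (2 * q) (frontier V).
Proof.
move=> lV mq ge g12.
have Vz' : [set w | forall k, support V k < cross (om ^+ k) w] z by rewrite -cell_support.
have tight' : forall k x, (forall w, [set w | forall k, support V k < cross (om ^+ k) w] w ->
  x <= cross (om ^+ k) w) -> x <= support V k.
  by rewrite -cell_support; exact: support_tight.
pose t := side_length om (support V).
have t_g : forall k, t (k + g)%N = t k.
  rewrite -ge; apply: periodic_gcd; last exact: (side_length_per omm (support_per V)).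
  have [c [h1 h2]] := component_rotation lV.
  have := @side_length_rot _ _ _ m1 om1 om_pos _ tight' (e * l) c.
  by rewrite -cell_support => /(_ h1 h2).
have reg := @frontier_regular _ _ _ m1 om1 omm om_pos _ _ (support_per V) Vz' tight' g _ q _ (esym mq).
have ge0 := @side_length_ge0 _ _ _ m1 om1 omm om_pos _ _ (support_per V) Vz' tight'.
rewrite -cell_support -/t in reg ge0.
have all := @frontier_all_sides _ _ _ m1 om1 omm om_pos _ _ (support_per V) Vz' tight'.
rewrite -cell_support -/t in all.
have [k0 tk0] := some_side m1 om1 omm om_pos (support_per V) Vz' tight'.
rewrite -/t in tk0.
have t_mod i j : i = j %[mod g] -> t i = t j by exact: periodic_mod.
case: g12 => g1; rewrite {}g1 in mq t_mod reg *.
  by left; apply: (reg 0%N (t k0)) => //= k; [rewrite modn1|move=> _; apply: t_mod; rewrite !modn1].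
have t_parity k : t k = t (odd k) by apply: t_mod; rewrite !modn2 oddb.
have [t0|t0] := ltP 0 (t 0%N); last first.
  have t00 : t 0%N = 0 by apply/le_anti; rewrite t0 ge0.
  left; apply: (reg 1%N (t 1%N)) => // [k|k|].
  - by rewrite modn2 t_parity; case: (odd k).
  - by rewrite modn2 t_parity; case: (odd k).
  - by move: tk0; rewrite (t_parity k0); case: (odd k0); rewrite ?t00 ?ltxx.
have [t1|t1] := ltP 0 (t 1%N); last first.
  have t10 : t 1%N = 0 by apply/le_anti; rewrite t1 ge0.
  left; apply: (reg 0%N (t 0%N)) => // k.
  - by rewrite modn2 t_parity; case: (odd k).
  - by rewrite modn2 t_parity; case: (odd k).
by right; split=> //; rewrite -mq; apply: all => k; rewrite t_parity; case: (odd k).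
Qed.


End Cell.
End RootComponent.

(** * The multiplier of a rational angle as a power of a root of unity *)

Section RationalAngle.
Context {R : realType}.
Implicit Types (a b : R).

Lemma expiD a b : expi (a + b) = expi a * expi b.
Proof. by apply/eqP; rewrite eq_complex /= cosD sinD eqxx [X in _ == X]addrC eqxx. Qed.

Lemma expiX a n : expi a ^+ n = expi (a * n%:R).
Proof.
elim: n => [|n IH]; first by rewrite mulr0 /expi cos0 sin0.
by rewrite exprSr IH -expiD -natr1 mulrDr mulr1.
Qed.

Lemma dot_expi a : dot (expi a) (expi a) = 1.
Proof. by rewrite /dot /= -!expr2 cos2Dsin2. Qed.

Lemma expi_root (m : nat) : (0 < m)%N -> expi (pi / m%:R : R) ^+ m = -1.
Proof.
move=> m0; rewrite expiX divfK ?pnatr_eq0 -?lt0n // /expi cospi sinpi.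
by apply/eqP; rewrite eq_complex /= oppr0 !eqxx.
Qed.

Lemma Im_expi_root_gt0 (m b : nat) : (0 < b < m)%N -> 0 < complex.Im (expi (pi / m%:R : R) ^+ b).
Proof.
move=> /andP[b0 bm]; rewrite expiX /=; have m0 : (0 < m)%N by exact: leq_trans bm.
apply: sin_gt0_pi; rewrite mulr_gt0 ?divr_gt0 ?pi_gt0 ?ltr0n //=.
by rewrite mulrAC ltr_pdivrMr ?ltr0n // ltr_pM2l ?pi_gt0 // ltr_nat.
Qed.

Lemma expi_rational (p q m g : nat) : (0 < q)%N -> (0 < m)%N -> (2 * m = g * q)%N ->
  expi (2 * pi * p%:R / q%:R : R) = expi (pi / m%:R) ^+ (g * p).
Proof.
move=> q0 m0 mq; rewrite expiX; congr expi.
have := congr1 (fun n => n%:R : R) mq; rewrite !natrM => {}mq.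
have q0' : q%:R != 0 :> R by rewrite pnatr_eq0 -lt0n.
have m0' : m%:R != 0 :> R by rewrite pnatr_eq0 -lt0n.
have -> : g%:R = 2 * m%:R / q%:R :> R by rewrite mq mulfK.
by field; rewrite q0' m0'.
Qed.

(** A real multiplier would give [q] dividing [2 * p], hence 2. This is where [2 < q] enters: for
    [q] equal to 1 or 2 the components are the two open half planes bounded by the real line. *)
Lemma Im_rational_neq0 (p q m g : nat) : (2 < q)%N -> (1 < m)%N -> coprime p q ->
  (0 < g)%N -> (2 * m = g * q)%N ->
  complex.Im (expi (pi / m%:R : R) ^+ (g * p)) != 0.
Proof.
move=> q2 m1 pq g0 mq; have m0 : (0 < m)%N by lia.
apply/eqP => im0.
have : (2 * m %| 2 * (g * p))%N.
  have c0 : cross (expi (pi / m%:R : R) ^+ 0) (expi (pi / m%:R) ^+ (g * p)) = 0.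
    by rewrite -[(g * p)%N]add0n (cross_om (dot_expi _)).
  have := cross_om_eq0 m1 (dot_expi _) (expi_root m0) (@Im_expi_root_gt0 m) c0.
  rewrite add0n => -[e|e].
    by apply: dvdn_mull; rewrite /dvdn -e mod0n.
  by rewrite /dvdn -modnMmr -e modnMmr modnn.
rewrite mq mulnCA dvdn_pmul2l // Gauss_dvdl ?(coprime_sym q) // => /dvdn_leq.
by lia.
Qed.

Variables (p q : nat).
Hypothesis p0 : (0 < p)%N.
Hypothesis q2 : (2 < q)%N.
Hypothesis pq : coprime p q.
Let g := if odd q then 2%N else 1%N.
Let lam : R[i] := expi (2 * pi * p%:R / q%:R).

(** The signs of the sides require a root with [om ^+ m = -1]. For odd [q] no [q]-th root of unity
    has this property, which is why [g] doubles the order. *)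
Lemma rational_root : exists m,
  [/\ (1 < m)%N, (2 * m = g * q)%N, lam = expi (pi / m%:R) ^+ (g * p) &
      complex.Im (expi (pi / m%:R : R) ^+ (g * p)) != 0].
Proof.
have [m m1 mq] : exists2 m, (1 < m)%N & (2 * m = g * q)%N.
  rewrite /g; case: ifPn => qo; first by exists q => //; exact: ltnW.
  exists q./2; last by rewrite mul2n even_halfK ?mul1n.
  by have := even_halfK qo; lia.
have g0 : (0 < g)%N by rewrite /g; case: ifP.
exists m; split=> //; first by apply: expi_rational => //; lia.
exact: (@Im_rational_neq0 p q).
Qed.

Lemma rational_component_polygon (V : set (plane R)) : is_regular_component lam V ->
  exists n, is_convex_polygon n (frontier V) /\ (n <= g * q)%N.
Proof.
have [m [m1 mq lamE lam_im]] := rational_root; have m0 : (0 < m)%N by lia.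
rewrite lamE -mq => -[z zreg ->]; rewrite component_cell //; last by rewrite dotX ?dot_expi.
exact: (component_polygon m1 (dot_expi _) (expi_root m0) (@Im_expi_root_gt0 m) lam_im zreg).
Qed.

Lemma rational_component_periodic (V : set (plane R)) (l : nat) :
  is_regular_component lam V -> iter l (F lam) @` V = V -> coprime l q ->
  is_regular_polygon q (frontier V) \/ (odd q /\ is_convex_polygon (2 * q) (frontier V)).
Proof.
have [m [m1 mq lamE lam_im]] := rational_root; have m0 : (0 < m)%N by lia.
rewrite lamE => -[z zreg ->]; rewrite component_cell //; last by rewrite dotX ?dot_expi.
move=> lV lq.
have gcdE : gcdn (g * p * l) (2 * m) = g.
  by rewrite mq -mulnA -muln_gcdr -[RHS]muln1; congr (_ * _)%N; apply/eqP; rewrite -/(coprime _ _) coprimeMl pq lq.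
have [] := component_periodic m1 (dot_expi _) (expi_root m0) (@Im_expi_root_gt0 m) lam_im zreg lV mq gcdE.
- by rewrite /g; case: ifP; [right|left].
- by left.
- by rewrite /g => -[+ poly]; case: (odd q) poly => // poly _; right; split.
Qed.

End RationalAngle.

(** * Triangles *)

Lemma ordS_neq n (i : 'I_n) : (1 < n)%N -> ordS i != i.
Proof.
move=> n1; apply/eqP => /(congr1 val) /= e; have lt := ltn_ord i.
have [iS|iS] := ltnP i.+1 n; first by move: e; rewrite modn_small //; lia.
have iE : i.+1 = n by lia.
by move: e; rewrite iE modnn; lia.
Qed.

Lemma ordSS_neq n (i : 'I_n) : (2 < n)%N -> ordS (ordS i) != i.
Proof.
move=> n2; apply/eqP => /(congr1 val) /= e; have lt := ltn_ord i.
have [iS|iS] := ltnP i.+1 n.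
  rewrite (modn_small iS) in e; have [iSS|iSS] := ltnP i.+2 n.
    by move: e; rewrite modn_small //; lia.
  have iE : i.+2 = n by lia.
  by move: e; rewrite iE modnn; lia.
have iE : i.+1 = n by lia.
by move: e; rewrite iE modnn modn_small; lia.
Qed.

Section Triangle.
Variable R : realType.
Implicit Types (x y u w A B C : R[i]).

(* A linear form that vanishes at the vertex [v (ordS k)] and is positive on the
   rest of the polygon. *)
Definition apex_form n (v : 'I_n -> R[i]) k x : R :=
  cross (v (ordS (ordS k)) - v (ordS k)) (x - v (ordS k)) +
  cross (v (ordS k) - v k) (x - v (ordS k)).

Lemma apex_formE n (v : 'I_n -> R[i]) k x y t :
  apex_form v k (line_path x y t%:C) = (1 - t) * apex_form v k x + t * apex_form v k y.
Proof. by rewrite /apex_form !crossB !cross_line; ring. Qed.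

Lemma apex_form_vertex n (v : 'I_n -> R[i]) k j : convex_vertices v -> j != ordS k ->
  0 < apex_form v k (v j).
Proof.
move=> [n2 vc] jk; rewrite /apex_form.
have -> : cross (v (ordS k) - v k) (v j - v (ordS k)) = cross (v (ordS k) - v k) (v j - v k).
  by have := crossv (v (ordS k) - v k); rewrite !crossB; lra.
have [jE|jS] := eqVneq j (ordS (ordS k)).
  by rewrite jE crossv add0r vc ?ordSS_neq // ordS_neq // ltnW.
rewrite ltr_wpDr ?vc //; have [->|jk'] := eqVneq j k; first by rewrite subrr cross0.
exact/ltW/vc.
Qed.

Lemma apex_form_gt0 n (v : 'I_n -> R[i]) k x : convex_vertices v -> perimeter v x ->
  x <> v (ordS k) -> 0 < apex_form v k x.
Proof.
move=> vc [j _ [t]]; rewrite /= in_itv /= => /andP[t0 t1] <-.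
have n2 := vc.1; rewrite apex_formE.
have f0 : apex_form v k (v (ordS k)) = 0 by rewrite /apex_form subrr !cross0 addr0.
have ge0 l : 0 <= apex_form v k (v l).
  by have [->|/(apex_form_vertex vc)/ltW//] := eqVneq l (ordS k); rewrite f0.
have [jk|jk] := eqVneq j (ordS k).
  have Sj : ordS j != ordS k by rewrite jk ordS_neq // ltnW.
  have := apex_form_vertex vc Sj; rewrite jk f0 mulr0 add0r => p ne.
  rewrite mulr_gt0 // lt_neqAle t0 andbT eq_sym; apply/eqP => te; apply: ne.
  by rewrite te line_pathE mul0r addr0.
have p := apex_form_vertex vc jk.
have [Sj|Sj] := eqVneq (ordS j) (ordS k).
  rewrite Sj f0 mulr0 addr0 => ne; rewrite mulr_gt0 // subr_gt0 lt_neqAle t1 andbT.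
  by apply/eqP => te; apply: ne; rewrite te line_pathE mul1r; ring.
move=> _; have p' := apex_form_vertex vc Sj.
have [->|tn0] := eqVneq t 0; first by rewrite subr0 mul1r mul0r addr0.
by rewrite ltr_wpDl // ?mulr_ge0 ?subr_ge0 // mulr_gt0 // lt_neqAle eq_sym tn0.
Qed.

Lemma vertex_neq n (v : 'I_n -> R[i]) i j : convex_vertices v -> j != i -> v j <> v i.
Proof.
move=> vc; rewrite -(ord_predK i) => ji vij.
by have := apex_form_vertex vc ji; rewrite vij /apex_form subrr !cross0 addr0 ltxx.
Qed.

Definition triangle A B C : set (plane R) :=
  [set w | [/\ 0 < cross (B - A) (w - A), 0 < cross (C - B) (w - B)
             & 0 < cross (A - C) (w - C)]].

Definition closed_triangle A B C : set (plane R) :=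
  [set w | [/\ 0 <= cross (B - A) (w - A), 0 <= cross (C - B) (w - B)
             & 0 <= cross (A - C) (w - C)]].

Lemma triangle_rot A B C : triangle A B C = triangle B C A.
Proof. by apply/seteqP; split=> w []. Qed.

Lemma barycentric A B C w :
  (cross (B - A) (C - A))%:C * w =
  (cross (C - B) (w - B))%:C * A + (cross (A - C) (w - C))%:C * B +
  (cross (B - A) (w - A))%:C * C.
Proof.
case: A B C w => [? ?] [? ?] [? ?] [? ?]; rewrite /cross; apply/eqP.
by rewrite eq_complex /=; apply/andP; split; apply/eqP; ring.
Qed.

Lemma barycentric_sum A B C w :
  cross (C - B) (w - B) + cross (A - C) (w - C) + cross (B - A) (w - A) =
  cross (B - A) (C - A).
Proof. by case: A B C w => [? ?] [? ?] [? ?] [? ?]; rewrite /cross /=; ring. Qed.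

Lemma open_triangle A B C : open (triangle A B C).
Proof.
have -> : triangle A B C = [set w | cross (B - A) A < cross (B - A) w] `&`
    [set w | cross (C - B) B < cross (C - B) w] `&` [set w | cross (A - C) C < cross (A - C) w].
  by apply/seteqP; split=> w /=; rewrite /triangle /= !crossB !subr_gt0 => -[] //; case.
by apply: openI; [apply: openI|]; exact: open_half_plane.
Qed.

Lemma frontier_triangle A B C : 0 < cross (B - A) (C - A) ->
  frontier (triangle A B C) = closed_triangle A B C `\` triangle A B C.
Proof.
move=> D0.
(* The defaults 0 here and -1 for [b] turn all further indices into the trivial constraint -1 < 0,
   so the family can be indexed by [nat]. *)
pose u (k : nat) := nth 0 [:: B - A; C - B; A - C] k.
pose b (k : nat) := nth (-1) [:: cross (B - A) A; cross (C - B) B; cross (A - C) C] k.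
have TE : triangle A B C = [set w | forall k, b k < cross (u k) w].
  apply/seteqP; split=> w /=.
    move=> [h1 h2 h3] [|[|[|k]]]; try by rewrite /u /b /= -subr_gt0 -crossB.
    by rewrite /u /b /= !nth_nil /cross /= !mul0r subr0 ltrN10.
  by move=> h; split; rewrite crossB subr_gt0; [exact: (h 0)|exact: (h 1%N)|exact: (h 2%N)].
have TcE : closed_triangle A B C = [set w | forall k, b k <= cross (u k) w].
  apply/seteqP; split=> w /=.
    move=> [h1 h2 h3] [|[|[|k]]]; try by rewrite /u /b /= -subr_ge0 -crossB.
    by rewrite /u /b /= !nth_nil /cross /= !mul0r subr0 lerN10.
  by move=> h; split; rewrite crossB subr_ge0; [exact: (h 0)|exact: (h 1%N)|exact: (h 2%N)].
rewrite /frontier (interior_id _).1; last exact: open_triangle.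
congr (_ `\` _); rewrite TE TcE.
apply: (@closure_half_planes _ _ _ _ ((3^-1)%:C * (A + B + C))).
move=> [|[|[|k]]]; rewrite /u /b /=; last first.
  by rewrite !nth_nil /cross /= !mul0r subr0 ltrN10.
all: by move: D0; rewrite /cross; case: (A) (B) (C) => [? ?] [? ?] [? ?] /=; lra.
Qed.

(* A point in the relative interior of a side is the midpoint of a segment
   contained in that side. *)
Lemma side_point_midpoint A B C w : 0 < cross (B - A) (C - A) ->
  cross (B - A) (w - A) = 0 -> 0 < cross (C - B) (w - B) -> 0 < cross (A - C) (w - C) ->
  exists2 u, u != 0 & frontier (triangle A B C) (w + u) /\ frontier (triangle A B C) (w - u).
Proof.
move=> D0 w1 w2 w3; rewrite (frontier_triangle D0).
pose D := cross (B - A) (C - A).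
have sum := barycentric_sum A B C w; rewrite w1 addr0 -/D in sum.
pose a := cross (C - B) (w - B); pose b := cross (A - C) (w - C).
pose e := Num.min a b / D.
have e0 : 0 < e by rewrite divr_gt0 // lt_min w2.
have ea : e * D <= a by rewrite /e divfK ?gt_eqF // ge_min lexx.
have eb : e * D <= b by rewrite /e divfK ?gt_eqF // ge_min lexx orbT.
have c2 : cross (C - B) (B - A) = - D by rewrite /D /cross; case: (A) (B) (C) => [? ?] [? ?] [? ?] /=; ring.
have c3 : cross (A - C) (B - A) = D by rewrite /D /cross; case: (A) (B) (C) => [? ?] [? ?] [? ?] /=; ring.
exists (e%:C * (B - A)).
  rewrite mulf_neq0 //; first by rewrite eq_complex /= gt_eqF.
  by apply/eqP => BA; move: D0; rewrite BA crossC cross0 oppr0 ltxx.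
have in_side s : - e <= s -> s <= e ->
    (closed_triangle A B C `\` triangle A B C) (w + s%:C * (B - A)).
  move=> s1 s2; have E u x : cross u (w + s%:C * (B - A) - x) = cross u (w - x) + s * cross u (B - A).
    by rewrite !(crossD, crossZ, crossN); ring.
  split; last by move=> []; rewrite E w1 crossv mulr0 addr0 ltxx.
  by rewrite /closed_triangle /= !E w1 crossv c2 c3 -/a -/b; split; nra.
split; first by apply: in_side; lra.
by rewrite -mulNr -rmorphN; apply: in_side; lra.
Qed.

(** A vertex of a convex polygon is never the midpoint of two other points of the perimeter, since
    [apex_form] is positive at both and odd about the vertex. Points inside a side of the triangle
    are such midpoints. *)
Lemma regular_vertex A B C n (v : 'I_n -> R[i]) i : 0 < cross (B - A) (C - A) ->
  convex_vertices v -> frontier (triangle A B C) = perimeter v ->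
  [\/ v i = A, v i = B | v i = C].
Proof.
move=> D0 vc SE; rewrite -(ord_predK i); set k := ord_pred i; set w := v (ordS k).
have no_mid u : u != 0 -> frontier (triangle A B C) (w + u) ->
    frontier (triangle A B C) (w - u) -> False.
  move=> u0; rewrite SE => p1 p2.
  have ne1 : w + u <> w by move/eqP; rewrite addrC -subr_eq0 addrK (negPf u0).
  have ne2 : w - u <> w by move/eqP; rewrite addrC -subr_eq0 addrK oppr_eq0 (negPf u0).
  have := apex_form_gt0 vc p1 ne1; have := apex_form_gt0 vc p2 ne2.
  by rewrite /apex_form -/w ![w + _]addrC !addrK !crossN; lra.
have Sw : frontier (triangle A B C) w.
  rewrite SE; exists (ordS k) => //; exists 0; first by rewrite /= in_itv /= lexx ler01.
  by rewrite line_pathE mul0r addr0.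
have D1 : 0 < cross (C - B) (A - B).
  by move: D0; rewrite /cross; case: (A) (B) (C) => [? ?] [? ?] [? ?] /=; lra.
have D2 : 0 < cross (A - C) (B - C).
  by move: D0; rewrite /cross; case: (A) (B) (C) => [? ?] [? ?] [? ?] /=; lra.
have meet P Q S : 0 < cross (Q - P) (S - P) -> cross (Q - P) (w - P) = 0 ->
    cross (S - Q) (w - Q) = 0 -> w = Q.
  move=> D3 h1 h2; apply: (@cross_eq2 _ (Q - P) (S - Q)).
  - rewrite gt_eqF //; move: D3; rewrite /cross; case: (P) (Q) (S) => [? ?] [? ?] [? ?] /=; lra.
  - by have := crossv (Q - P); move: h1; rewrite !crossB; lra.
  - by apply/eqP; rewrite -subr_eq0 -crossB h2.
move: Sw; rewrite (frontier_triangle D0) => -[[h1 h2 h3] nT].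
have [z1|z1] := eqVneq (cross (B - A) (w - A)) 0.
  have [z2|z2] := eqVneq (cross (C - B) (w - B)) 0.
    by constructor 2; apply: (meet A B C).
  have [z3|z3] := eqVneq (cross (A - C) (w - C)) 0.
    by constructor 1; apply: (meet C A B).
  have [||u u0 [p1 p2]] := side_point_midpoint D0 z1; rewrite ?lt_neqAle 1?eq_sym ?z2 ?z3 //.
  by case: (no_mid u).
have [z2|z2] := eqVneq (cross (C - B) (w - B)) 0.
  have [z3|z3] := eqVneq (cross (A - C) (w - C)) 0.
    by constructor 3; apply: (meet B C A).
  have [||u u0] := side_point_midpoint D1 z2; rewrite ?lt_neqAle 1?eq_sym ?z1 ?z3 //.
  by rewrite -triangle_rot => -[p1 p2]; case: (no_mid u).
have [z3|z3] := eqVneq (cross (A - C) (w - C)) 0.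
  have [||u u0] := side_point_midpoint D2 z3; rewrite ?lt_neqAle 1?eq_sym ?z1 ?z2 //.
  by rewrite triangle_rot => -[p1 p2]; case: (no_mid u).
by case: nT; split; rewrite lt_neqAle eq_sym ?z1 ?z2 ?z3.
Qed.

(** Consecutive vertices take their values among [A], [B], [C], so the fourth repeats the first and
    the three sides in between are those of the triangle; equal lengths contradict the
    hypothesis. *)
Lemma triangle_not_regular A B C : 0 < cross (B - A) (C - A) ->
  Normc.normc (B - A) <> Normc.normc (A - C) ->
  ~ exists n, is_regular_polygon n (frontier (triangle A B C)).
Proof.
move=> D0 ne [n [v [vc SE eqv _]]].
have n2 := vc.1; have n0 : (0 < n)%N by lia.
pose i0 := Ordinal n0; pose i1 := ordS i0; pose i2 := ordS i1; pose i3 := ordS i2.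
have ne01 : v i1 <> v i0 by apply: vertex_neq => //; rewrite ordS_neq // ltnW.
have ne12 : v i2 <> v i1 by apply: vertex_neq => //; rewrite ordS_neq // ltnW.
have ne02 : v i2 <> v i0 by apply: vertex_neq => //; rewrite ordSS_neq.
have ne23 : v i3 <> v i2 by apply: vertex_neq => //; rewrite ordS_neq // ltnW.
have ne13 : v i3 <> v i1 by apply: vertex_neq => //; rewrite ordSS_neq.
have vE i := regular_vertex i D0 vc SE.
have v30 : v i3 = v i0.
  by move: ne01 ne12 ne02 ne23 ne13; case: (vE i0) (vE i1) (vE i2) (vE i3) => -> [] -> [] -> [] ->.
have e1 := eqv i0 i1; have e2 := eqv i1 i2; rewrite -/i1 -/i2 -/i3 v30 in e1 e2.
have nC x y : Normc.normc (x - y) = Normc.normc (y - x) by rewrite -opprB normcN.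
apply: ne; move: ne01 ne12 ne02 e1 e2; case: (vE i0) (vE i1) (vE i2) => -> [] -> [] -> // _ _ _;
  rewrite ?(nC B A) ?(nC C A) ?(nC C B); congruence.
Qed.

End Triangle.

(** * A triangular component for the angle 7 pi / 6 *)

(* [(a, b, c, d)] encodes (a + b zeta + c zeta^2 + d zeta^3) / 3 with
   zeta = expi (pi / 6), so that zeta^4 = zeta^2 - 1. *)
Definition zpoint := (int * int * int * int)%type.

Definition zsgn (e : bool) : int := if e then 1 else -1.

(** The multiplier is zeta^7 = - zeta. Subtracting the sign changes [a] by 3 because of the common
    denominator, and zeta^4 is reduced to zeta^2 - 1. *)
Definition zstep (e : bool) (P : zpoint) : zpoint :=
  let: (a, b, c, d) := P in (d, zsgn e * 3 - a, - b - d, - c).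

(* [(zim P).1 + (zim P).2 * sqrt 3] is six times the imaginary part of [P]. *)
Definition zim (P : zpoint) : int * int := let: (a, b, c, d) := P in (b + 2 * d, c).

Definition zsign (e : bool) (x : int * int) : int * int :=
  (zsgn e * x.1, zsgn e * x.2).

(** Sign test for m + c sqrt 3: for opposite signs, m^2 is compared with 3 c^2. *)
Definition zpos (x : int * int) : bool :=
  let: (m, c) := x in
  [|| [&& 0 <= m, 0 <= c & (m != 0) || (c != 0)],
      [&& 0 <= m, c < 0 & 3 * c ^+ 2 < m ^+ 2] |
      [&& m < 0, 0 <= c & m ^+ 2 < 3 * c ^+ 2]].

Definition znneg (x : int * int) : bool := (x == (0, 0)) || zpos x.

(* The signs of the imaginary parts along the orbit of the triangle: [true] for
   the upper half plane. After these 36 steps the triangle returns to itself. *)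
Definition code : seq bool :=
  [:: true; true; true; true; true; false; false; true; false; false; true; false;
      false; true; false; true; true; false; true; true; false; true; false; false;
      true; false; false; true; false; false; true; true; true; true; true; true].

Definition ztriple := (zpoint * zpoint * zpoint)%type.

Definition ztraj (n : nat) : ztriple :=
  foldl (fun (T : ztriple) e => (zstep e T.1.1, zstep e T.1.2, zstep e T.2))
    ((12, -12, 0, 6), (0, 2, 0, -1), (0, 9, -12, 6)) (take n code).

(** Vertices may land on the real line; one vertex strictly off it suffices for all positive
    combinations, that is, for the open triangle. *)
Definition zcheck (n : nat) : bool :=
  let e := nth true code n in let T := ztraj n in
  let x := zsign e (zim T.1.1) in let y := zsign e (zim T.1.2) in
  let z := zsign e (zim T.2) in
  [&& znneg x, znneg y, znneg z & [|| zpos x, zpos y | zpos z]].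

Lemma zcheck_all : all zcheck (iota 0 36).
Proof. by vm_compute. Qed.

Lemma ztraj_period : ztraj 36 = ztraj 0.
Proof. by vm_compute. Qed.

Lemma ztrajS n : (n < 36)%N -> let e := nth true code n in
  ztraj n.+1 = (zstep e (ztraj n).1.1, zstep e (ztraj n).1.2, zstep e (ztraj n).2).
Proof. by move=> n36; rewrite /ztraj (take_nth true) // foldl_rcons. Qed.

(** The lower bound places [B] to the right of [A], and the upper bound places [C] above the real
    line. *)
Lemma sqrt3_bounds (R : realType) (s : R) : 0 < s -> s * s = 3 -> 12 < 7 * s /\ 12 * s < 21.
Proof.
move=> s0 s2; rewrite !ltNge; split; apply/negP => h.
  have : 0 <= (12 - 7 * s) * (12 + 7 * s) by apply: mulr_ge0; lra.
  by lra.
have : 0 <= (12 * s - 21) * (12 * s + 21) by apply: mulr_ge0; lra.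
by lra.
Qed.

Section Twelve.
Context {R : realType} (s : R).
Hypothesis s0 : 0 < s.
Hypothesis s2 : s * s = 3.
Implicit Types (z w : R[i]) (al be ga : R).

Let lam : R[i] := (- s / 2) +i* (- 1 / 2).

Definition zval (P : zpoint) : R[i] := let: (a, b, c, d) := P in
  ((a%:~R + b%:~R * s / 2 + c%:~R / 2) / 3) +i* ((b%:~R / 2 + c%:~R * s / 2 + d%:~R) / 3).

Lemma zval_step e P : zval (zstep e P) = lam * (zval P - ((zsgn e)%:~R)%:C).
Proof.
case: P => [[[a b] c] d]; apply/eqP; rewrite eq_complex /=.
rewrite !(rmorphB, rmorphN, rmorphM) /=.
have hb : b%:~R * (s * s) = b%:~R * 3 :> R by rewrite s2.
have hc : c%:~R * (s * s) = c%:~R * 3 :> R by rewrite s2.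
by apply/andP; split; apply/eqP; lra.
Qed.

Definition zreal (x : int * int) : R := x.1%:~R + x.2%:~R * s.

Lemma Im_zval P : complex.Im (zval P) = zreal (zim P) / 6.
Proof.
by case: P => [[[a b] c] d] /=; rewrite /zreal /= rmorphD rmorphM /=; field.
Qed.

Lemma zreal_sign e x : zreal (zsign e x) = (zsgn e)%:~R * zreal x.
Proof. by rewrite /zreal /= !rmorphM /=; ring. Qed.

Lemma zpos_gt0 x : zpos x -> 0 < zreal x.
Proof.
case: x => m c; rewrite /zreal /= -!(ler0z R) -!(ltrz0 R) -(ltr_int R) -(ltr_int R (m ^+ 2)).
rewrite !(rmorphM, rmorphXn) /= -!(intr_eq0 R).
move: (m%:~R) (c%:~R) => {}m {}c; case/or3P=> /and3P[h1 h2 h3].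
- case/orP: h3 => h3.
    by rewrite ltr_wpDr ?mulr_ge0 ?(ltW s0) // lt_neqAle eq_sym h3.
  have c0 : 0 < c by rewrite lt_neqAle eq_sym h3.
  by rewrite ltr_wpDl // mulr_gt0.
- rewrite ltNge; apply/negP => h4.
  have : m * m <= (- (c * s)) * (- (c * s)) by apply: ler_pM => //; lra.
  have : c * c * (s * s) = c * c * 3 by rewrite s2.
  by nra.
- rewrite ltNge; apply/negP => h4.
  have : (c * s) * (c * s) <= (- m) * (- m) by apply: ler_pM => //; rewrite ?mulr_ge0 ?(ltW s0) //; lra.
  have : c * c * (s * s) = c * c * 3 by rewrite s2.
  by nra.
Qed.

Lemma znneg_ge0 x : znneg x -> 0 <= zreal x.
Proof.
by case/orP=> [/eqP ->|/zpos_gt0/ltW//]; rewrite /zreal /= mul0r addr0.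
Qed.

Definition comb al be ga (T : ztriple) : R[i] :=
  al%:C * zval T.1.1 + be%:C * zval T.1.2 + ga%:C * zval T.2.

Lemma Im_comb al be ga T e : let x := zsign e (zim T.1.1) in
  let y := zsign e (zim T.1.2) in let z := zsign e (zim T.2) in
  (zsgn e)%:~R * complex.Im (comb al be ga T) =
  (al * zreal x + be * zreal y + ga * zreal z) / 6.
Proof.
rewrite /= !zreal_sign /comb; have := Im_zval T.2; have := Im_zval T.1.2; have := Im_zval T.1.1.
case: (zval T.1.1) (zval T.1.2) (zval T.2) => [? ?] [? ?] [? ?] /= -> -> ->.
by field.
Qed.

(** While the sides follow [code], each step is affine and so commutes with combinations of total
    weight 1. *)
Lemma comb_orbit al be ga w n : al + be + ga = 1 -> w = comb al be ga (ztraj 0) ->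
  (n <= 36)%N ->
  (forall k, (k < n)%N -> side (iter k (F lam) w) = (zsgn (nth true code k))%:~R) ->
  iter n (F lam) w = comb al be ga (ztraj n).
Proof.
move=> sum1 wE; elim: n => [//|n IH] n36 sides.
rewrite iterS /F HE sides // IH ?(ltnW n36) //; last by move=> k kn; apply: sides; exact: ltnW.
rewrite ztrajS // /comb /= !zval_step.
set e := _%:~R%:C; have eE : (al%:C + be%:C + ga%:C) * e = e.
  by rewrite -!rmorphD sum1 mul1r.
by rewrite -{1}eE; ring.
Qed.

Lemma side_sgn e z : 0 < (zsgn e)%:~R * complex.Im z -> side z = (zsgn e)%:~R.
Proof.
rewrite /side; case: e => /=; rewrite ?mul1r ?mulN1r; first by move/ltW ->.
by rewrite oppr_gt0 ltNge => /negbTE ->.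
Qed.

Let A := zval (ztraj 0).1.1.
Let B := zval (ztraj 0).1.2.
Let C := zval (ztraj 0).2.
Let T := triangle A B C.

Lemma zcheckP n : (n < 36)%N -> zcheck n.
Proof. by move=> n36; apply: (allP zcheck_all); rewrite mem_iota. Qed.

Lemma comb_sign al be ga n : 0 < al -> 0 < be -> 0 < ga -> (n < 36)%N ->
  0 < (zsgn (nth true code n))%:~R * complex.Im (comb al be ga (ztraj n)).
Proof.
move=> al0 be0 ga0 n36; rewrite Im_comb divr_gt0 //.
case/and4P: (zcheckP n36) => /znneg_ge0 h1 /znneg_ge0 h2 /znneg_ge0 h3.
have p1 := mulr_ge0 (ltW al0) h1; have p2 := mulr_ge0 (ltW be0) h2.
have p3 := mulr_ge0 (ltW ga0) h3; case/or3P=> /zpos_gt0.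
- by move/(mulr_gt0 al0); lra.
- by move/(mulr_gt0 be0); lra.
- by move/(mulr_gt0 ga0); lra.
Qed.

Lemma AE : A = (4 - 2 * s) +i* 0.
Proof.
rewrite (_ : A = zval (12, -12, 0, 6)) // /zval !(rmorphN, rmorph_nat, rmorph0, rmorph1). 
by apply/eqP; rewrite eq_complex; apply/andP; split; apply/eqP; rewrite /complex.Re /complex.Im; field.
Qed.

Lemma BE : B = (s / 3) +i* 0.
Proof.
rewrite (_ : B = zval (0, 2, 0, -1)) // /zval !(rmorphN, rmorph_nat, rmorph0, rmorph1). 
by apply/eqP; rewrite eq_complex; apply/andP; split; apply/eqP; rewrite /complex.Re /complex.Im; field.
Qed.

Lemma CE : C = (3 / 2 * s - 2) +i* (7 / 2 - 2 * s).
Proof.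
rewrite (_ : C = zval (0, 9, -12, 6)) // /zval !(rmorphN, rmorph_nat, rmorph0, rmorph1). 
by apply/eqP; rewrite eq_complex; apply/andP; split; apply/eqP; rewrite /complex.Re /complex.Im; field.
Qed.

Lemma area_gt0 : 0 < cross (B - A) (C - A).
Proof.
have [s_lo s_hi] := sqrt3_bounds s0 s2.
rewrite AE BE CE /cross /= !subr0 mul0r subr0.
by rewrite mulr_gt0 //; lra.
Qed.

Lemma comb_coords w : exists al be ga,
  [/\ al + be + ga = 1, w = comb al be ga (ztraj 0) &
      T w <-> [/\ 0 < al, 0 < be & 0 < ga]].
Proof.
have D0 := area_gt0; set D := cross _ _ in D0; have Dn0 := lt0r_neq0 D0.
exists (cross (C - B) (w - B) / D), (cross (A - C) (w - C) / D), (cross (B - A) (w - A) / D).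
split.
- by rewrite -!mulrDl barycentric_sum divff.
- apply: (mulfI (_ : D%:C != 0)); first by rewrite eq_complex /= negb_and Dn0.
  rewrite /D barycentric /comb -/A -/B -/C !mulrDr !mulrA -!rmorphM /=.
  by rewrite ![D * _]mulrC !divfK.
- by rewrite /T /triangle /= !pmulr_lgt0 ?invr_gt0 //; split=> -[].
Qed.

Lemma triangle_orbit w n : T w -> (n < 36)%N ->
  0 < (zsgn (nth true code n))%:~R * complex.Im (iter n (F lam) w).
Proof.
have [al [be [ga [sum1 wE ->]]]] := comb_coords w => -[al0 be0 ga0].
elim/ltn_ind: n => n IH n36; rewrite (comb_orbit sum1 wE (ltnW n36)) ?comb_sign // => k kn.
by apply: side_sgn; apply: IH => //; exact: ltn_trans n36.
Qed.

Lemma triangle_return w : T w -> iter 36 (F lam) w = w.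
Proof.
move=> Tw; have [al [be [ga [sum1 wE _]]]] := comb_coords w.
rewrite (comb_orbit sum1 wE (leqnn _)) ?ztraj_period // => k k36.
by apply: side_sgn; exact: triangle_orbit.
Qed.

Lemma triangle_orbit_mod w n : T w -> iter n (F lam) w = iter (n %% 36) (F lam) w.
Proof.
move=> Tw; rewrite {1}(divn_eq n 36) addnC iterD; congr (iter _ _ _).
by elim: (n %/ 36)%N => // d IH; rewrite mulSn iterD IH triangle_return.
Qed.

Lemma triangle_side w n : T w ->
  side (iter n (F lam) w) = (zsgn (nth true code (n %% 36)))%:~R.
Proof.
by move=> Tw; rewrite triangle_orbit_mod //; apply: side_sgn; apply: triangle_orbit => //; exact: ltn_pmod.
Qed.

Lemma lam_unimod : dot lam lam = 1.
Proof.
by rewrite /dot /=; transitivity ((s * s + 1) / 4); [field|rewrite s2; field].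
Qed.

Lemma cell_triangle z : T z -> cell lam z = T.
Proof.
move=> Tz; apply/seteqP; split=> w; last first.
  move=> Tw n; rewrite triangle_side // triangle_orbit_mod //.
  by apply: triangle_orbit => //; exact: ltn_pmod.
move=> zw; have [al [be [ga [sum1 wE ->]]]] := comb_coords w.
have pos n x y v : (n < 36)%N -> let e := nth true code n in
    (zsign e (zim (ztraj n).1.1), zsign e (zim (ztraj n).1.2), zsign e (zim (ztraj n).2)) =
    (x, y, v) -> 0 < al * zreal x + be * zreal y + ga * zreal v.
  move=> n36 e [<- <- <-]; rewrite -(@pmulr_lgt0 _ 6^-1) ?invr_gt0 // -Im_comb.
  rewrite -(comb_orbit sum1 wE (ltnW n36)).
    by have := zw n; rewrite triangle_side // modn_small.
  by move=> k kn; rewrite (cell_side zw) triangle_side // modn_small //; exact: ltn_trans n36.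
have z0 : zreal (0, 0) = 0 by rewrite /zreal /= mul0r addr0.
have z1 : 0 < zreal (21, -12) by exact: zpos_gt0.
have z2 : 0 < zreal (-12, 7) by exact: zpos_gt0.
(* At the times 0, 5 and 34 one side of the triangle lies on the real line. Two vertices then
   contribute zero, and the sign of the iterate is that of the third barycentric coordinate. *)
have := @pos 0 (0, 0) (0, 0) (21, -12) isT erefl.
have := @pos 5 (0, 0) (-12, 7) (0, 0) isT erefl.
have := @pos 34 (21, -12) (0, 0) (0, 0) isT erefl.
by rewrite z0 !mulr0 ?add0r ?addr0 !pmulr_lgt0.
Qed.

Lemma triangle_component : exists2 V : set (plane R), is_regular_component lam V &
  ~ exists n, is_regular_polygon n (frontier V).
Proof.
have D0 := area_gt0; pose z := comb 3^-1 3^-1 3^-1 (ztraj 0).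
have Tz : T z.
  have zE : z = (3^-1)%:C * (A + B + C) by rewrite /z /comb -/A -/B -/C -!mulrDr.
  rewrite zE; split; move: D0; move: (A) (B) (C) => [? ?] [? ?] [? ?]; rewrite /cross /=; lra.
have cellT : (cell lam z)° = T.
  by rewrite cell_triangle // (interior_id _).1 //; exact: open_triangle.
have zreg : regular_set lam z.
  by apply: (@interior_cell_regular _ lam z); rewrite cellT.
exists T; first by exists z => //; rewrite (component_cell lam_unimod zreg) cellT.
apply: triangle_not_regular => // e; have := congr1 (fun x => x ^+ 2) e.
rewrite !sqr_normc; apply/eqP; rewrite -subr_eq0.
have [s_lo s_hi] := sqrt3_bounds s0 s2.
(* The side AB has length (7 s - 12) / 3, and the angle of 120 degrees at [B] makes the squared
   length of AC three times as large. *)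
have -> : dot (B - A) (B - A) - dot (A - C) (A - C) = - (2 / 9) * (7 * s - 12) ^+ 2.
  rewrite AE BE CE /dot /=.
  transitivity (- (2 / 9) * (7 * s - 12) ^+ 2 + (s * s - 3) / 12); first by field.
  by rewrite s2 subrr mul0r addr0.
by rewrite mulf_neq0 ?expf_neq0 ?oppr_eq0 // gt_eqF // subr_gt0.
Qed.

End Twelve.

Lemma expi_7_12 (R : realType) : exists2 s : R, 0 < s /\ s * s = 3 &
  expi (2 * pi * 7%:R / 12%:R) = (- s / 2) +i* (- 1 / 2).
Proof.
pose x : R := pi / 6; have pi0 := pi_gt0 R.
have c0 : 0 < cos x by apply: cos_gt0_pihalf; rewrite /x; apply/andP; split; lra.
have n0 : 0 < sin x by apply: sin_gt0_pi; rewrite /x; apply/andP; split; lra.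
(* The vanishing real part of the cube gives cos^2 = 3 sin^2, which determines both values at pi /
   6; the angle itself is pi / 6 + pi. *)
have cube : expi x ^+ 3 = 'i.
  rewrite expiX /x; have -> : pi / 6 * 3%:R = pi / 2 :> R by field.
  by rewrite /expi cos_pihalf sin_pihalf.
have cs := cos2Dsin2 x.
have c3 : cos x ^+ 2 = 3 * sin x ^+ 2.
  move: cube; rewrite exprS expr2 => /(congr1 (@complex.Re R)) /= e.
  apply: (mulfI (lt0r_neq0 c0)); apply/eqP; rewrite -subr_eq0; apply/eqP.
  by rewrite -[RHS]e; ring.
have s12 : sin x = 1 / 2.
  have /eqP : (sin x - 1 / 2) * (sin x + 1 / 2) = 0.
    by transitivity (sin x ^+ 2 - 1 / 4); [field|lra].
  by rewrite mulf_eq0 => /orP[]/eqP; lra.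
exists (2 * cos x).
  split; first by rewrite mulr_gt0.
  by transitivity (4 * cos x ^+ 2); [ring|rewrite c3 s12; field].
have -> : 2 * pi * 7%:R / 12%:R = x + pi :> R by rewrite /x; field.
rewrite /expi cosDpi sinDpi s12; congr (_ +i* _); first by field.
by rewrite mulNr.
Qed.

Unset Implicit Arguments.
Local Close Scope complex_scope.

Theorem theoremB (R : realType) :
  (forall p q : nat, (0 < p)%N -> (2 < q)%N -> coprime p q ->
    let lambda : R[i] := expi (2 * pi * p%:R / q%:R) in
    (forall V : set (plane R), is_regular_component lambda V ->
      exists n : nat, is_convex_polygon n (frontier V) /\
        (n <= if odd q then 2 * q else q)%N) /\
    (forall (V : set (plane R)) (l : nat),
      is_regular_component lambda V -> is_period lambda V l -> coprime l q ->
      is_regular_polygon q (frontier V) \/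
      (odd q /\ is_convex_polygon (2 * q) (frontier V)))) /\
  (exists p q : nat, [/\ (0 < p)%N, (2 < q)%N, coprime p q &
    exists2 V : set (plane R),
      is_regular_component (expi (2 * pi * p%:R / q%:R)) V &
      ~ exists n : nat, is_regular_polygon n (frontier V)]).
Proof.
split=> [p q p0 q2 pq lambda|].
  split=> [V cV|V l cV [_ lV _] lq].
    have [n [nV nq]] := rational_component_polygon p0 q2 pq cV; exists n; split=> //.
    by move: nq; case: (odd q); rewrite ?mul1n.
  exact: rational_component_periodic cV lV lq.
exists 7%N, 12%N; split=> //; have [s [s0 s2] ->] := expi_7_12 R.
exact: triangle_component s0 s2.
Qed.
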